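(* Let $(M,L)$ be a Finsler manifold which admits a concurrent $\pi$-vector field $\overline{\zeta}$. Then the following assertions are equivalent: (a) $(M,L)$ is a Berwald manifold; (b) $(M,L)$ is a Landsberg manifold; (c) $(M,L)$ is a Riemannian manifold.
   Context: $M$ is a real paracompact smooth manifold of finite dimension $n$; all objects are $C^\infty$. $\pi:\mathcal{T}M\to M$ is the bundle of nonzero tangent vectors, $\pi^{-1}(TM)\to\mathcal{T}M$ the pullback of $TM$ by $\pi$. Sections of $\pi^{-1}(TM)$ are called $\pi$-vector fields, are written with bars, and form the module $\mathfrak{X}(\pi(M))$. The fundamental $\pi$-vector field is $\overline{\eta}(u)=(u,u)$. $\rho:T(\mathcal{T}M)\to\pi^{-1}(TM)$ is $\rho=(\pi_{\mathcal{T}M},d\pi)$, and $\gamma:\pi^{-1}(TM)\to T(\mathcal{T}M)$ is the vertical lift $\gamma(u,v)=j_u(v)$, with $j_u:T_{\pi(u)}M\to T_u(T_{\pi(u)}M)$ the natural isomorphism. $(M,L)$ is a Finsler manifold with Finsler metric $g$ on $\pi^{-1}(TM)$ (locally $g_{ij}=\frac12\partial^2L^2/\partial y^i\partial y^j$). For a linear connection $D$ on $\pi^{-1}(TM)$ its connection map is $K(X)=D_X\overline{\eta}$; $D$ is regular if $T_u(\mathcal{T}M)=V_u(\mathcal{T}M)\oplus\ker K_u$ for all $u$ ($V$ the vertical bundle), and then its horizontal map is $\beta:=(\rho|_{\ker K})^{-1}$. The torsion is $\mathbf{T}(X,Y)=D_X\rho Y-D_Y\rho X-\rho[X,Y]$,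 with $Q(\overline{X},\overline{Y})=\mathbf{T}(\beta\overline{X},\beta\overline{Y})$ and $T(\overline{X},\overline{Y})=\mathbf{T}(\gamma\overline{X},\beta\overline{Y})$. The curvature is $\mathbf{K}(X,Y)\rho Z=-D_XD_Y\rho Z+D_YD_X\rho Z+D_{[X,Y]}\rho Z$, with $P(\overline{X},\overline{Y})\overline{Z}=\mathbf{K}(\beta\overline{X},\gamma\overline{Y})\overline{Z}$ and $\widehat{P}(\overline{X},\overline{Y})=P(\overline{X},\overline{Y})\overline{\eta}$. The Cartan connection $\nabla$ is the unique regular connection on $\pi^{-1}(TM)$ with $\nabla g=0$, $Q=0$ and $g(T(\overline{X},\overline{Y}),\overline{Z})=g(T(\overline{X},\overline{Z}),\overline{Y})$. Below $\beta,T,\widehat{P}$ are those of $\nabla$. A $\pi$-vector field $\overline{\zeta}$ is concurrent if $\nabla_{\beta\overline{X}}\overline{\zeta}=-\overline{X}$ and $\nabla_{\gamma\overline{X}}\overline{\zeta}=0$ for all $\overline{X}$. $(M,L)$ is: a Berwald manifold if $\nabla_{\beta\overline{X}}T=0$ for all $\overline{X}$; a Landsberg manifold if $\widehat{P}(\overline{X},\overline{Y})=0$ for all $\overline{X},\overline{Y}$ (equivalently $\nabla_{\beta\overline{\eta}}T=0$); Riemannian if $g(x,y)$ is independent of $y$ (equivalently $T=0$).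
   Formalization: In dimension 1, ''g(x,y) is independent of y'' is read on each half-line of T_xM minus 0 separately, since otherwise L = y for y>0, -2y for y<0 (concurrent field -x, T = 0) is a counterexample; for n at least 2 it is literal independence. *)

(* Defs.v *)
(* Finsler geometry in the pullback formalism.
   Conventions.
   - The model space of M is E = 'rV[R]_n.  T_p M is identified with E through
     the preferred chart at p, so that a tangent vector of M is a pair
     (p, v) : M * 'rV[R]_n, and T_u(TM) is identified with E * E through the
     chart of TM induced by the preferred chart at u.1.
   - The slit tangent bundle is the set of the u : M * 'rV[R]_n with u.2 != 0.
   - Functions, vector fields and pi-vector fields are total functions on
     M * 'rV[R]_n.  They are local objects, subject to smoothness in a
     neighbourhood of the point where they are used. *)
From HB Require Import structures.
From mathcomp Require Import all_boot all_order all_algebra.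
From mathcomp Require Import all_classical all_reals all_analysis.

Set Implicit Arguments.
Unset Strict Implicit.
Unset Printing Implicit Defensive.
Import Order.TTheory GRing.Theory Num.Theory.
Import numFieldNormedType.Exports.
Local Open Scope classical_set_scope.
Local Open Scope ring_scope.

(* C^oo: all iterated directional derivatives exist and are differentiable. *)
Definition iter_derive (R : realType) (V W : normedModType R)
    (s : seq V) (f : V -> W) : V -> W :=
  foldr (fun v h => 'D_v h) f s.

Definition smooth_near (R : realType) (V W : normedModType R)
    (f : V -> W) (z : V) : Prop :=
  \forall x \near z, forall s : seq V, differentiable (iter_derive s f) x.

Definition paracompact (T : topologicalType) : Prop :=
  forall C : set (set T),
    (forall A, C A -> open A) -> \bigcup_(A in C) A = setT ->
    exists C' : set (set T),
      [/\ forall B, C' B -> open B,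
          \bigcup_(B in C') B = setT,
          forall B, C' B -> exists2 A, C A & B `<=` A &
          forall x : T, exists2 N, nbhs x N &
            finite_set [set B | C' B /\ B `&` N !=set0]].

(* A family of charts indexed by the points: [chart c p] is the preferred chart
   around p, [ichart c p] its inverse.  Every atlas has a subatlas of this form,
   with the same maximal atlas. *)
Record charts (N V : Type) := Charts {
  chart_dom : N -> set N;
  chart : N -> N -> V;
  ichart : N -> V -> N }.

Record smooth_manifold (R : realType) (n : nat) (M : topologicalType)
    (c : charts M 'rV[R]_n) : Prop := SmoothManifold {
  manifold_hausdorff : hausdorff_space M;
  manifold_paracompact : paracompact M;
  chart_dom_mem : forall p, chart_dom c p p;
  chart_dom_open : forall p, open (chart_dom c p);
  chart_image_open : forall p, open (chart c p @` chart_dom c p);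
  chartK : forall p q, chart_dom c p q -> ichart c p (chart c p q) = q;
  chart_continuous :
    forall p q, chart_dom c p q -> {for q, continuous (chart c p)};
  ichart_continuous :
    forall p x, (chart c p @` chart_dom c p) x ->
      {for x, continuous (ichart c p)};
  transition_smooth :
    forall p q x, (chart c p @` (chart_dom c p `&` chart_dom c q)) x ->
      smooth_near (chart c q \o ichart c p) x }.

Section Calculus.
Context {R : realType} {V : normedModType R} {N : Type} (c : charts N V).

Definition smooth_at (W : normedModType R) (f : N -> W) (u : N) : Prop :=
  smooth_near (f \o ichart c u) (chart c u u).

Definition vderive (u : N) (w : V) (f : N -> R) : R :=
  'd (f \o ichart c u) (chart c u u) w.

(* The components in the chart [chart c u] of a tangent vector w at q. *)
Definition pushvec (u q : N) (w : V) : V :=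
  'd (chart c u \o ichart c q) (chart c q q) w.

Definition vfield_rep (u : N) (X : N -> V) : V -> V :=
  fun z => let q := ichart c u z in pushvec u q (X q).

Definition vfield_smooth_at (X : N -> V) (u : N) : Prop :=
  smooth_near (vfield_rep u X) (chart c u u).

(* The Lie bracket, with the sign [X, Y] f = X (Y f) - Y (X f). *)
Definition bracket (X Y : N -> V) : N -> V := fun u =>
  'd (vfield_rep u Y) (chart c u u) (X u)
  - 'd (vfield_rep u X) (chart c u u) (Y u).

End Calculus.

Section Pullback.
Context {R : realType} {n : nat} {M : Type} (c : charts M 'rV[R]_n).
Local Notation E := 'rV[R]_n.
Local Notation TM := (M * 'rV[R]_n)%type.
Local Notation TTM := ('rV[R]_n * 'rV[R]_n)%type.

Definition slit (u : TM) : Prop := u.2 != 0.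

Definition tangent_charts : charts TM TTM := {|
  chart_dom := fun u => [set a | chart_dom c u.1 a.1];
  chart := fun u a => (chart c u.1 a.1, pushvec c u.1 a.1 a.2);
  ichart := fun u z => let q := ichart c u.1 z.1 in
    (q, 'd (chart c q \o ichart c u.1) (z.1) z.2) |}.
Local Notation tc := tangent_charts.

(* A pi-vector field is a map Y : TM -> E; Y u is an element of T_(u.1) M. *)
Definition psection_rep (u : TM) (Y : TM -> E) : TTM -> E :=
  fun z => let q := ichart tc u z in pushvec c u.1 q.1 (Y q).

Definition psection_smooth_at (Y : TM -> E) (u : TM) : Prop :=
  smooth_near (psection_rep u Y) (chart tc u u).

Definition eta : TM -> E := fun u => u.2.

Definition rho (u : TM) (w : TTM) : E :=
  'd (chart c u.1 \o fst \o ichart tc u) (chart tc u u) w.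

Definition vlift (u : TM) (v : E) : TTM :=
  'd (fun y : E => chart tc u (u.1, y)) (u.2) v.

Definition frho (X : TM -> TTM) : TM -> E := fun u => rho u (X u).
Definition fvlift (X : TM -> E) : TM -> TTM := fun u => vlift u (X u).

(* [D u w Y] is the covariant derivative at u of Y along w in T_u(TM). *)
Definition connection_op := TM -> TTM -> (TM -> E) -> E.

Definition cov (D : connection_op) (X : TM -> TTM) (Y : TM -> E) : TM -> E :=
  fun u => D u (X u) Y.

(* A linear connection on the pullback bundle over the slit tangent bundle,
   acting on local sections. *)
Record linear_connection (D : connection_op) : Prop := LinearConnection {
  conn_linear : forall u Y, slit u -> psection_smooth_at Y u ->
    forall (a : R) w w', D u (a *: w + w') Y = a *: D u w Y + D u w' Y;
  conn_additive : forall u Y Y', slit u ->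
    psection_smooth_at Y u -> psection_smooth_at Y' u ->
    forall w, D u w (fun a => Y a + Y' a) = D u w Y + D u w Y';
  conn_leibniz : forall u f Y, slit u ->
    smooth_at tc (f : TM -> R) u -> psection_smooth_at Y u ->
    forall w, D u w (fun a => f a *: Y a) =
      vderive tc u w f *: Y u + f u *: D u w Y;
  conn_local : forall u Y Y', slit u ->
    psection_smooth_at Y u -> psection_smooth_at Y' u ->
    (\forall z \near chart tc u u, Y (ichart tc u z) = Y' (ichart tc u z)) ->
    forall w, D u w Y = D u w Y';
  conn_smooth : forall u X Y, slit u ->
    vfield_smooth_at tc X u -> psection_smooth_at Y u ->
    psection_smooth_at (cov D X Y) u }.

Section Connection.
Variable D : connection_op.

Definition conn_map (u : TM) (w : TTM) : E := D u w eta.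

(* T_u(TM) is the direct sum of the vertical space ker (rho u) and of
   ker (conn_map u), at each nonzero u. *)
Definition regular : Prop := forall u, slit u ->
  (forall w, exists a b,
     [/\ rho u a = 0, conn_map u b = 0 & w = a + b]) /\
  (forall w, rho u w = 0 -> conn_map u w = 0 -> w = 0).

Definition hlift (u : TM) (v : E) : TTM :=
  xget 0 [set w | conn_map u w = 0 /\ rho u w = v].

Definition fhlift (X : TM -> E) : TM -> TTM := fun u => hlift u (X u).

Definition torsion (X Y : TM -> TTM) : TM -> E := fun u =>
  cov D X (frho Y) u - cov D Y (frho X) u - rho u (bracket tc X Y u).

Definition htorsion (X Y : TM -> E) := torsion (fhlift X) (fhlift Y).

Definition hvtorsion (X Y : TM -> E) := torsion (fvlift X) (fhlift Y).

(* The argument Z stands for rho Z in the usual expression of the curvature. *)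
Definition curvature (X Y : TM -> TTM) (Z : TM -> E) : TM -> E := fun u =>
  - cov D X (cov D Y Z) u + cov D Y (cov D X Z) u
  + cov D (bracket tc X Y) Z u.

Definition hvcurvature (X Y Z : TM -> E) : TM -> E :=
  curvature (fhlift X) (fvlift Y) Z.

Definition hvcurvature_eta (X Y : TM -> E) : TM -> E := hvcurvature X Y eta.

(* (nabla_(beta X) T)(Y, Z) *)
Definition hderive_hvtorsion (X Y Z : TM -> E) : TM -> E := fun u =>
  cov D (fhlift X) (hvtorsion Y Z) u
  - hvtorsion (cov D (fhlift X) Y) Z u
  - hvtorsion Y (cov D (fhlift X) Z) u.

Definition concurrent (zeta : TM -> E) : Prop :=
  (forall u, slit u -> psection_smooth_at zeta u) /\
  forall u X, slit u -> psection_smooth_at X u ->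
    cov D (fhlift X) zeta u = - X u /\ cov D (fvlift X) zeta u = 0.

Definition berwald : Prop := forall u X Y Z, slit u ->
  psection_smooth_at X u -> psection_smooth_at Y u ->
  psection_smooth_at Z u -> hderive_hvtorsion X Y Z u = 0.

Definition landsberg : Prop := forall u X Y, slit u ->
  psection_smooth_at X u -> psection_smooth_at Y u ->
  hvcurvature_eta X Y u = 0.

End Connection.

Definition finsler_metric (L : TM -> R) (u : TM) (v w : E) : R :=
  2^-1 * 'D_v ('D_w (fun y : E => L (u.1, y) ^+ 2)) (u.2).

Record finsler (L : TM -> R) : Prop := Finsler {
  finsler_continuous :
    forall u, {for chart tc u u, continuous (L \o ichart tc u)};
  finsler_smooth : forall u, slit u -> smooth_at tc L u;
  finsler_pos : forall u, slit u -> 0 < L u;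
  finsler_homogeneous :
    forall p (y : E) (t : R), 0 < t -> L (p, t *: y) = t * L (p, y);
  finsler_posdef :
    forall u, slit u -> forall v, v != 0 -> 0 < finsler_metric L u v v }.

Record cartan_connection (L : TM -> R) (D : connection_op) : Prop := Cartan {
  cartan_linear : linear_connection D;
  cartan_regular : regular D;
  cartan_metrical : forall u Y Z, slit u ->
    psection_smooth_at Y u -> psection_smooth_at Z u ->
    forall w, vderive tc u w (fun a => finsler_metric L a (Y a) (Z a)) =
      finsler_metric L u (D u w Y) (Z u) + finsler_metric L u (Y u) (D u w Z);
  cartan_htorsion : forall u X Y, slit u ->
    psection_smooth_at X u -> psection_smooth_at Y u -> htorsion D X Y u = 0;
  cartan_hvtorsion : forall u X Y Z, slit u ->
    psection_smooth_at X u -> psection_smooth_at Y u ->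
    psection_smooth_at Z u ->
    finsler_metric L u (hvtorsion D X Y u) (Z u) =
    finsler_metric L u (hvtorsion D X Z u) (Y u) }.

(* g(x, y) is independent of y: it is constant along the segments of
   T_x M \ {0}.  If n >= 2 any two nonzero vectors are joined by at most two
   such segments, see [riemannianP].  If n = 1, T_x M \ {0} consists of two
   half-lines; a positively homogeneous L may induce different metrics on them
   although T = 0, and y is then compared only with the vectors of its own
   half-line. *)
Definition riemannian (L : TM -> R) : Prop :=
  forall (x : M) (y y' : E),
    (forall t : R, 0 <= t <= 1 -> (1 - t) *: y + t *: y' != 0) ->
    forall v w, finsler_metric L (x, y) v w = finsler_metric L (x, y') v w.

End Pullback.

Lemma riemannianP (R : realType) (n : nat) (M : Type)
    (L : M * 'rV[R]_n -> R) : (1 < n)%N ->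
  riemannian L <->
  (forall (x : M) (y y' : 'rV[R]_n), y != 0 -> y' != 0 ->
     forall v w, finsler_metric L (x, y) v w = finsler_metric L (x, y') v w).
Proof.
move=> n1; split=> [H x y y' y0 y'0 v w|H x y y' yy' v w]; last first.
  apply: H.
    by have := yy' 0 ltac:(by rewrite lexx ler01);
       rewrite subr0 scale1r scale0r addr0.
  by have := yy' 1 ltac:(by rewrite lexx ler01);
     rewrite subrr scale1r scale0r add0r.
(* segments towards a vector outside the line of z avoid 0 *)
have seg (z a : 'rV[R]_n) : z != 0 -> ~~ (a <= z)%MS ->
    forall t : R, (1 - t) *: z + t *: a != 0.
  move=> z0 az t; apply/eqP => e.
  have [t0|t0] := eqVneq t 0.
    by move: e; rewrite t0 subr0 scale1r scale0r addr0; apply/eqP.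
  move/negP: az; apply; apply/sub_rVP; exists (- (t^-1 * (1 - t))).
  have : t^-1 *: ((1 - t) *: z + t *: a) = 0 by rewrite e scaler0.
  rewrite scalerDr !scalerA mulVf // scale1r => /eqP.
  by rewrite addrC addr_eq0 => /eqP ->; rewrite scaleNr.
have ex1 (z : 'rV[R]_n) : exists a : 'rV[R]_n, ~~ (a <= z)%MS.
  apply: contrapT => nex.
  have : (1%:M <= z)%MS.
    apply/row_subP => i; apply: contrapT => h.
    by apply: nex; exists (row i 1%:M); apply/negP.
  move/mxrankS; rewrite mxrank1 => /leq_trans /(_ (rank_leq_row z)).
  by rewrite leqNgt n1.
have [yy'|yy'] := boolP (y' <= y)%MS; last first.
  by apply: H => t _; exact: seg.
have [a ay] := ex1 y.
have ay' : ~~ (a <= y')%MS.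
  by apply: contra ay => h; apply: submx_trans h yy'.
rewrite (H x y a) => [|t _]; last exact: seg.
by rewrite (H x y' a) => [//|t _]; exact: seg.
Qed.

(* Main.v *)
Require Import Defs.
From HB Require Import structures.
From mathcomp Require Import all_boot all_order all_algebra.
From mathcomp Require Import all_classical all_reals all_analysis.
From mathcomp Require Import ring lra.

(** A concurrent field zeta forces the three properties at once; each of them is
    established, and the equivalences follow.

    Concurrence amounts to D_w zeta = - rho w for every tangent vector w of the slit
    bundle ([concurrent_conn]).  As g is parallel, the function g(zeta, zeta) has the
    differential w |-> -2 g(rho w, zeta).  This differential vanishes on vertical
    vectors, so g(zeta, zeta) is a function on the base, and then so are the
    coefficients of its differential, the covector g(zeta, -)
    ([pairing_locally_constant]).  Its vertical derivatives being zero, zeta lies in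
    the kernel of the Cartan tensor ([christoffel_concurrent]).  Two consequences
    are that zeta itself is constant along the fibres ([concurrent_fibre_constant])
    and, by the symmetry of the third derivatives of L ^ 2, that the derivative of
    the metric in the vertical direction zeta vanishes ([diff_metric_concurrent]).

    Let zeta be nonzero at (p, y) and write g_y for the metric at (p, y).  As long as
    y + t zeta avoids the origin g_y is invariant under this translation, and it is
    homogeneous of degree 0, so that g_y = g_(y + t zeta) = g_(zeta + y / t), which
    tends to g_zeta as t grows.  If the ray from y in the direction zeta meets the origin the same
    argument with - zeta applies.  So g_y takes at most two values along a segment
    that avoids the origin, and it is constant there by continuity
    ([metric_fibre_constant_nonzero]).  At a zero of zeta the differential of zeta
    is minus the identity on horizontal vectors; such a point is a limit of points
    where zeta is nonzero, and the vertical derivatives of the metric vanish by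
    continuity ([metric_derive_vert]).  Hence the manifold is Riemannian
    ([concurrent_riemannian]).

    The torsion T is therefore zero, and the manifold is Berwald.  By the Koszul
    formula the horizontal Christoffel symbols are functions on the base as well
    ([hchristoffel_near]).  The horizontal lift is then linear in the fibre
    coordinate, its vertical derivative cancels the Christoffel symbols in the
    curvature term that defines the Landsberg property ([riemannian_landsberg]).

    The computations are made in the chart of the tangent bundle at (p, y), which is
    the same for all y.  There a covariant derivative is a derivative plus
    Christoffel symbols ([connE]) and a torsion is an alternation of Christoffel
    symbols ([torsionE]).  The latter involves the bracket of horizontal lifts, which
    are smooth by Cramer's rule ([hlift_smooth]).  Smoothness being defined by
    iterated directional derivatives, its closure under composition expands a
    differential along finitely many fixed vectors ([ck_comp]). *)

Set Implicit Arguments.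
Unset Strict Implicit.
Unset Printing Implicit Defensive.
Import Order.TTheory GRing.Theory Num.Theory.
Import numFieldNormedType.Exports.
Local Open Scope classical_set_scope.
Local Open Scope ring_scope.

(** * Smooth functions between normed modules *)

Lemma nearS (T : topologicalType) (z : T) (P Q : T -> Prop) :
  (forall x, P x -> Q x) -> (\forall x \near z, P x) -> \forall x \near z, Q x.
Proof. by move=> PQ; apply: filterS. Qed.

Lemma nearS2 (T : topologicalType) (z : T) (P Q S : T -> Prop) :
  (forall x, P x -> Q x -> S x) -> (\forall x \near z, P x) ->
  (\forall x \near z, Q x) -> \forall x \near z, S x.
Proof. by move=> PQ; apply: filterS2. Qed.

Lemma nearT (T : topologicalType) (z : T) (P : T -> Prop) :
  (forall x, P x) -> \forall x \near z, P x.
Proof. by move=> H; apply: nearW. Qed.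

Lemma nearI (T : topologicalType) (z : T) (P Q : T -> Prop) :
  (\forall x \near z, P x) -> (\forall x \near z, Q x) ->
  \forall x \near z, P x /\ Q x.
Proof. by apply: filterS2. Qed.

Section NearEq.
Context {R : realType} {V W : normedModType R}.

Lemma diff_near_eq (f g : V -> W) (x : V) :
  (\forall z \near x, f z = g z) -> differentiable f x ->
  differentiable g x /\ 'd g x = 'd f x :> (V -> W).
Proof.
move=> fg df.
have fgx : f x = g x by exact: nbhs_singleton fg.
have E : g \o shift x = cst (g x) + 'd f x +o_ 0 id.
  apply/eqaddoP => e e0; have /eqaddoP /(_ e e0) := diff_locally df.
  have fg0 : \forall h \near 0, f (h + x) = g (h + x).
    by move: fg; rewrite (near_shift 0 x) /=; apply: filterS => h /=; rewrite subr0.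
  by apply: filterS2 fg0 => h /= fgh; rewrite !fctE /= fgh fgx.
have dg := @diff_unique _ _ _ g ('d f x) x (diff_continuous df) E.
split; last exact: dg.
by apply/diff_locallyP; rewrite dg; split => //; exact: diff_continuous.
Qed.

Lemma near_open_eq (f g : V -> W) (U : set V) (x : V) : open U -> U x ->
  (forall z, U z -> f z = g z) -> \forall z \near x, f z = g z.
Proof. by move=> oU Ux fg; apply: filterS (open_nbhs_nbhs (conj oU Ux)). Qed.

End NearEq.

Section Ck.
Context {R : realType}.

(** The recursion is on the innermost directional derivative: the closure of this
    class under an operation is then an induction on k that uses the first order
    rule for this operation only. *)
Fixpoint ck (V W : normedModType R) (k : nat) (U : set V) (f : V -> W) : Prop :=
  if k is k'.+1 then
    (forall x, U x -> differentiable f x) /\ forall v, ck k' U ('D_v f)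
  else True.

Definition smooth_on (V W : normedModType R) (U : set V) (f : V -> W) :=
  forall k, ck k U f.

Section Basic.
Context {V W : normedModType R}.
Implicit Types (f g : V -> W) (U : set V).

Lemma ck_eq k U f g : open U -> (forall x, U x -> f x = g x) ->
  ck k U f -> ck k U g.
Proof.
move=> oU; elim: k f g => [//|k IH] f g fg [df ckf]; split.
  by move=> x Ux; have [] := diff_near_eq (near_open_eq oU Ux fg) (df _ Ux).
move=> v; apply: IH (ckf v) => x Ux.
exact/near_eq_derive/(near_open_eq oU Ux fg).
Qed.

Lemma ck_sub k U U' f : U' `<=` U -> ck k U f -> ck k U' f.
Proof.
move=> UU; elim: k f => [//|k IH] f [df ckf]; split; first by move=> x /UU/df.
by move=> v; exact: IH (ckf v).
Qed.

Lemma ckS k U f : ck k.+1 U f -> ck k U f.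
Proof.
elim: k f => [//|k IH] f [df ckf]; split => // v; exact: IH (ckf v).
Qed.

Lemma ck_cst k U (a : W) : ck k U (cst a : V -> W).
Proof.
elim: k a => [//|k IH] a; split=> [x _|v]; first exact: differentiable_cst.
rewrite (_ : 'D_v _ = cst 0) //; apply/funext => x; exact: derive_cst.
Qed.

Lemma ckD k U f g : open U -> ck k U f -> ck k U g ->
  ck k U (fun x => f x + g x).
Proof.
move=> oU; elim: k f g => [//|k IH] f g [df cf] [dg cg]; split=> [x Ux|v].
  by apply: differentiableD; [apply: df|apply: dg].
apply: (ck_eq oU _ (IH _ _ (cf v) (cg v))) => x Ux; symmetry.
by apply: deriveD; apply: diff_derivable; [apply: df|apply: dg].
Qed.

Lemma ck_sum (I : Type) (r : seq I) k U (F : I -> V -> W) : open U ->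
  (forall i, ck k U (F i)) -> ck k U (fun x => \sum_(i <- r) F i x).
Proof.
move=> oU cF; elim: r => [|i r IH].
  by apply: (ck_eq oU _ (ck_cst k U 0)) => x _; rewrite big_nil.
by apply: (ck_eq oU _ (ckD oU (cF i) IH)) => x _; rewrite big_cons.
Qed.

End Basic.

Section Basic2.
Context {V W : normedModType R}.
Implicit Types (f g : V -> W) (U : set V).

Lemma ck_linear (W' : normedModType R) (l : {linear W -> W'}) k U f :
  continuous l -> open U -> ck k U f -> ck k U (fun x => l (f x)).
Proof.
move=> lc oU; elim: k f => [//|k IH] f [df cf].
have dl y : differentiable l y by exact: linear_differentiable.
split=> [x Ux|v]; first by apply: (@differentiable_comp _ _ _ _ f l); auto.
apply: (ck_eq oU _ (IH _ (cf v))) => x Ux.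
rewrite [RHS]deriveE; last by apply: (@differentiable_comp _ _ _ _ f l); auto.
by rewrite (@diff_comp _ _ _ _ f l) //=; [rewrite diff_lin // deriveE; auto|auto].
Qed.

Let scale_bilinear : bilinear_for
    (GRing.Scale.Law.clone _ _ *:%R _) (GRing.Scale.Law.clone _ _ *:%R _)
    (fun (a : R) (w : W) => a *: w).
Proof.
split=> [w|a] b x y /=; first by rewrite scalerDl scalerA.
by rewrite scalerDr !scalerA mulrC.
Qed.

(** The product rule, scaling being a continuous bilinear map. *)
Lemma is_diff_scale (s : V -> R) f x :
  differentiable s x -> differentiable f x ->
  is_diff x (fun x => s x *: f x) (fun v => s x *: 'd f x v + 'd s x v *: f x).
Proof.
move=> ds df.
pose B := bilinear_isBilinear.Build R R W W _ _ _ scale_bilinear.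
pose b : {bilinear R -> W -> W} := HB.pack (fun (a : R) (w : W) => a *: w) B.
have bc : continuous (fun p : R * W => b p.1 p.2) by exact: scale_continuous.
have db p := differentiable_bilin p bc.
have dp : differentiable (fun y => (s y, f y)) x by exact: differentiable_pair.
have E : (fun x => s x *: f x) = (fun p => b p.1 p.2) \o (fun y => (s y, f y)) by [].
apply: DiffDef; rewrite E; first exact: differentiable_comp.
by rewrite diff_comp // diff_bilin // diff_pair.
Qed.

Lemma ckZ (s : V -> R) k U f : open U -> ck k U s -> ck k U f ->
  ck k U (fun x => s x *: f x).
Proof.
move=> oU; elim: k s f => [//|k IH] s f cs cf; have [ds cDs] := cs.
have [df cDf] := cf; split=> [x Ux|v].
  by have [] := is_diff_scale (ds _ Ux) (df _ Ux).
apply: (ck_eq oU _ (ckD oU (IH _ _ (ckS cs) (cDf v)) (IH _ _ (cDs v) (ckS cf)))).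
move=> x Ux; have D := is_diff_scale (ds _ Ux) (df _ Ux).
by rewrite [RHS]deriveE ?diff_val ?deriveE//; auto.
Qed.

Lemma ck_pair (W' : normedModType R) k U f (g : V -> W') : open U ->
  ck k U f -> ck k U g -> ck k U (fun x => (f x, g x)).
Proof.
move=> oU; elim: k f g => [//|k IH] f g [df cf] [dg cg]; split=> [x Ux|v].
  by apply: differentiable_pair; [apply: df|apply: dg].
apply: (ck_eq oU _ (IH _ _ (cf v) (cg v))) => x Ux.
rewrite [RHS]deriveE; last by apply: differentiable_pair; auto.
by rewrite diff_pair /= ?deriveE; auto.
Qed.

End Basic2.

(** Finitely many continuous coordinates: what the chain rule needs of V to be
    expressed through directional derivatives along fixed vectors. *)
Record coordinates (V : normedModType R) := Coordinates {
  coord_idx : finType;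
  coord_vec : coord_idx -> V;
  coord_fun : coord_idx -> {linear V -> R};
  coord_fun_continuous : forall i, continuous (coord_fun i);
  coordE : forall v, v = \sum_i coord_fun i v *: coord_vec i }.
Arguments coord_vec {V} c i.
Arguments coord_fun {V} c i.
Arguments coordE {V} c v.

(** The chain rule expresses 'D_v (f o phi) through products of derivatives of phi
    and of the derivatives of f along the coordinate vectors composed with phi. *)
Lemma ck_comp (U0 V W : normedModType R) (co : coordinates V) k (U : set V)
    (U' : set U0) (f : V -> W) (phi : U0 -> V) :
  open U -> open U' -> (forall x, U' x -> U (phi x)) ->
  ck k U f -> ck k U' phi -> ck k U' (fun x => f (phi x)).
Proof.
move=> oU oU' UU; elim: k f phi UU => [//|k IH] f phi UU cf cphi.
have [df cDf] := cf; have [dphi cDphi] := cphi.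
have dfphi x : U' x -> differentiable (fun x => f (phi x)) x.
  move=> Ux; apply: (@differentiable_comp _ _ _ _ phi f); first exact: dphi.
  exact/df/UU.
split=> // v.
have S : ck k U' (fun x => \sum_i coord_fun co i ('D_v phi x) *:
    'D_(coord_vec co i) f (phi x)).
  apply: ck_sum => // i; apply: ckZ => //.
    by apply: ck_linear => //; [exact: coord_fun_continuous|exact: cDphi].
  exact: (IH ('D_(coord_vec co i) f) phi UU (cDf _) (ckS cphi)).
apply: (ck_eq oU' _ S) => x Ux.
have dfx := df _ (UU _ Ux); have dphix := dphi _ Ux.
rewrite [RHS]deriveE; last exact: dfphi.
rewrite (@diff_comp _ _ _ _ phi f) //= [in RHS](coordE co ('d phi x v)) linear_sum.
by apply: eq_bigr => i _; rewrite linearZ !deriveE.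
Qed.

Lemma ck_inv (V : normedModType R) k (U : set V) (s : V -> R) :
  open U -> (forall x, U x -> s x != 0) -> ck k U s ->
  ck k U (fun x => (s x)^-1).
Proof.
move=> oU s0; elim: k => [//|k IH] cs; have [ds cDs] := cs; split=> [x Ux|v].
  by apply: differentiableV; [exact: ds|exact: s0].
have C := IH (ckS cs).
have S : ck k U (fun x => (-1 : R) *: ((s x)^-1 *: ((s x)^-1 *: 'D_v s x))).
  do !apply: ckZ => //; [exact: ck_cst|exact: cDs].
apply: (ck_eq oU _ S) => x Ux; rewrite deriveV; [|exact: s0|exact/diff_derivable/ds].
by rewrite scalerA -expr2 scaleN1r scaleNr exprVn.
Qed.

End Ck.
Arguments coord_vec {R V} c i.
Arguments coord_fun {R V} c i.
Arguments coordE {R V} c v.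

Section SmoothNear.
Context {R : realType}.

Lemma near_open (T : topologicalType) (P : T -> Prop) (z : T) :
  (\forall x \near z, P x) ->
  exists U : set T, [/\ open U, U z & forall x, U x -> P x].
Proof.
by move=> Pz; have : nbhs z P by []; rewrite nbhsE => -[U [oU Uz] UP]; exists U.
Qed.

(** [iter_derive] adds derivatives on the outside and [ck] on the inside. *)
Lemma smooth_onP (V W : normedModType R) (U : set V) (f : V -> W) :
  smooth_on U f <-> forall x, U x -> forall s, differentiable (iter_derive s f) x.
Proof.
split=> [sf x Ux s|].
  elim/last_ind: s f sf => [|s v IH] f sf; first by have [d _] := sf 1%N; exact: d.
  rewrite /iter_derive foldr_rcons; apply: IH => k.
  by have [_ d] := sf k.+1; exact: d.
move=> H k; elim: k f H => [//|k IH] f H; split=> [x Ux|v].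
  exact: (H x Ux [::]).
apply: IH => x Ux s; have := H x Ux (rcons s v).
by rewrite /iter_derive foldr_rcons.
Qed.

Lemma smooth_nearP (V W : normedModType R) (f : V -> W) z :
  smooth_near f z <-> exists U : set V, [/\ open U, U z & smooth_on U f].
Proof.
split=> [|[U [oU Uz /smooth_onP sU]]]; last first.
  by apply: filterS (open_nbhs_nbhs (conj oU Uz)); exact: sU.
move=> /near_open[U [oU Uz sU]].
by exists U; split=> //; apply/smooth_onP => x /sU.
Qed.

Lemma smooth_near_near (V W : normedModType R) (f : V -> W) z :
  smooth_near f z -> \forall x \near z, smooth_near f x.
Proof.
move=> /smooth_nearP[U [oU Uz sU]].
apply: filterS (open_nbhs_nbhs (conj oU Uz)) => x Ux.
by apply/smooth_nearP; exists U.
Qed.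

Lemma smooth_near_diff (V W : normedModType R) (f : V -> W) z :
  smooth_near f z -> differentiable f z.
Proof. by move=> /nbhs_singleton /(_ [::]). Qed.

Lemma smooth_near_derive (V W : normedModType R) (f : V -> W) v z :
  smooth_near f z -> smooth_near ('D_v f) z.
Proof.
move=> /smooth_nearP[U [oU Uz sU]]; apply/smooth_nearP; exists U; split=> // k.
by have [_ d] := sU k.+1; exact: d.
Qed.

Lemma smooth_near_eq (V W : normedModType R) (f g : V -> W) z :
  (\forall x \near z, f x = g x) -> smooth_near f z -> smooth_near g z.
Proof.
move=> /near_open[A [oA Az fg]] /smooth_nearP[U [oU Uz sU]].
apply/smooth_nearP; exists (U `&` A); split; [exact: openI|by []|move=> k].
apply: (ck_eq (openI oU oA) (f := f)) => [x [_ /fg]//|].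
by apply: ck_sub (sU k) => x [].
Qed.

Lemma smooth_near_cst (V W : normedModType R) (a : W) (z : V) :
  smooth_near (fun _ : V => a) z.
Proof.
by apply/smooth_nearP; exists setT; split=> // [|k]; [exact: openT|exact: ck_cst].
Qed.

Lemma smooth_near_id (V : normedModType R) (z : V) : smooth_near (fun x : V => x) z.
Proof.
apply/smooth_nearP; exists setT; split=> // [|[//|k]]; first exact: openT.
split=> [x _|v]; first by have [] := is_diff_id x.
apply: (ck_eq openT _ (ck_cst k setT v)) => x _; symmetry.
exact: (derive_id x v).
Qed.

Lemma smooth_near2 (V W1 W2 W : normedModType R) (f : V -> W1) (g : V -> W2)
    (h : V -> W) z :
  (forall k U, open U -> ck k U f -> ck k U g -> ck k U h) ->
  smooth_near f z -> smooth_near g z -> smooth_near h z.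
Proof.
move=> H /smooth_nearP[U [oU Uz sU]] /smooth_nearP[U' [oU' Uz' sU']].
apply/smooth_nearP; exists (U `&` U'); split; [exact: openI|by []|move=> k].
apply: H; first exact: openI.
  by apply: ck_sub (sU k) => x [].
by apply: ck_sub (sU' k) => x [].
Qed.

Lemma smooth_nearD (V W : normedModType R) (f g : V -> W) z :
  smooth_near f z -> smooth_near g z -> smooth_near (fun x => f x + g x) z.
Proof. by apply: smooth_near2 => k U; exact: ckD. Qed.

Lemma smooth_nearZ (V W : normedModType R) (s : V -> R) (f : V -> W) z :
  smooth_near s z -> smooth_near f z -> smooth_near (fun x => s x *: f x) z.
Proof. by apply: smooth_near2 => k U; exact: ckZ. Qed.

Lemma smooth_nearM (V : normedModType R) (s f : V -> R) z :
  smooth_near s z -> smooth_near f z -> smooth_near (fun x => s x * f x) z.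
Proof. exact: smooth_nearZ. Qed.

Lemma smooth_near_pair (V W W' : normedModType R) (f : V -> W) (g : V -> W') z :
  smooth_near f z -> smooth_near g z -> smooth_near (fun x => (f x, g x)) z.
Proof. by apply: smooth_near2 => k U; exact: ck_pair. Qed.

Lemma smooth_near_linear (V W W' : normedModType R) (l : {linear W -> W'})
    (f : V -> W) z : continuous l ->
  smooth_near f z -> smooth_near (fun x => l (f x)) z.
Proof.
by move=> lc sf; apply: (smooth_near2 _ sf sf) => k U oU cf _; exact: ck_linear.
Qed.

Lemma smooth_near_sum (I : Type) (r : seq I) (V W : normedModType R)
    (F : I -> V -> W) z : (forall i, smooth_near (F i) z) ->
  smooth_near (fun x => \sum_(i <- r) F i x) z.
Proof.
move=> sF; elim: r => [|i r IH].
  apply: (smooth_near_eq _ (smooth_near_cst 0 z)).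
  by near=> x; rewrite big_nil.
apply: (smooth_near_eq _ (smooth_nearD (sF i) IH)).
by near=> x; rewrite big_cons.
Unshelve. all: by end_near. Qed.

Lemma smooth_near_prod (I : Type) (r : seq I) (V : normedModType R)
    (F : I -> V -> R) z : (forall i, smooth_near (F i) z) ->
  smooth_near (fun x => \prod_(i <- r) F i x) z.
Proof.
move=> sF; elim: r => [|i r IH].
  apply: (smooth_near_eq _ (smooth_near_cst (1 : R) z)).
  by near=> x; rewrite big_nil.
apply: (smooth_near_eq _ (smooth_nearM (sF i) IH)).
by near=> x; rewrite big_cons.
Unshelve. all: by end_near. Qed.

Lemma smooth_near_inv (V : normedModType R) (s : V -> R) z :
  s z != 0 -> smooth_near s z -> smooth_near (fun x => (s x)^-1) z.
Proof.
move=> s0 ss; have sc := differentiable_continuous (smooth_near_diff ss).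
have : \forall x \near z, s x != 0.
  exact: (sc _ (open_nbhs_nbhs (conj (@open_neq _ 0) s0))).
move=> /near_open[A [oA Az sA]]; move: ss => /smooth_nearP[U [oU Uz sU]].
apply/smooth_nearP; exists (U `&` A); split; [exact: openI|by []|move=> k].
apply: ck_inv; [exact: openI|by move=> x [_ /sA]|].
by apply: ck_sub (sU k) => x [].
Qed.

Lemma smooth_near_comp (U0 V W : normedModType R) (co : coordinates V)
    (f : V -> W) (phi : U0 -> V) z :
  smooth_near f (phi z) -> smooth_near phi z ->
  smooth_near (fun x => f (phi x)) z.
Proof.
move=> /smooth_nearP[U [oU Uz sU]] /smooth_nearP[U' [oU' Uz' sU']].
have oI : open (U' `&` phi @^-1` U).
  rewrite openE => x [Ux Uphi]; apply: filterI.
    exact: open_nbhs_nbhs.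
  have [d _] := sU' 1%N; have c := differentiable_continuous (d _ Ux).
  exact: (c _ (open_nbhs_nbhs (conj oU Uphi))).
apply/smooth_nearP; exists (U' `&` phi @^-1` U); split=> // k.
apply: (ck_comp co oU oI); [by move=> x []|exact: sU|].
by apply: ck_sub (sU' k) => x [].
Qed.

End SmoothNear.

Section Coordinates.
Context {R : realType}.

Section Row.
Context {n : nat}.

Definition row_coord (i : 'I_n) (v : 'rV[R]_n) : R := v 0 i.
Fact row_coord_linear i : linear (row_coord i).
Proof. by move=> a v w; rewrite /row_coord !mxE. Qed.
HB.instance Definition _ i :=
  GRing.isLinear.Build R 'rV[R]_n R *:%R (row_coord i) (row_coord_linear i).

Fact row_coord_continuous i : continuous (row_coord i).
Proof. by move=> v; exact: coord_continuous. Qed.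

Fact row_coordE (v : 'rV[R]_n) : v = \sum_i row_coord i v *: delta_mx 0 i.
Proof. exact: row_sum_delta. Qed.

Definition row_coordinates : coordinates 'rV[R]_n :=
  @Coordinates _ _ 'I_n (fun i => delta_mx 0 i) (fun i => row_coord i : {linear _ -> _})
    row_coord_continuous row_coordE.
End Row.

Section Prod.
Context {V1 V2 : normedModType R} (c1 : coordinates V1) (c2 : coordinates V2).

Let pvec (i : coord_idx c1 + coord_idx c2) : V1 * V2 :=
  match i with inl i => (coord_vec c1 i, 0) | inr i => (0, coord_vec c2 i) end.

Let pfun (i : coord_idx c1 + coord_idx c2) : {linear (V1 * V2)%type -> R} :=
  match i with
  | inl i => coord_fun c1 i \o fst
  | inr i => coord_fun c2 i \o snd
  end.

Fact pfun_continuous i : continuous (pfun i).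
Proof.
case: i => i v; apply: continuous_comp.
- exact: cvg_fst.
- exact: coord_fun_continuous.
- exact: cvg_snd.
- exact: coord_fun_continuous.
Qed.

Fact pfunE (v : V1 * V2) : v = \sum_i pfun i v *: pvec i.
Proof.
rewrite big_sumType /=; case: v => a b /=.
have -> : \sum_i coord_fun c1 i a *: ((coord_vec c1 i, 0) : V1 * V2) = (a, 0).
  rewrite [in RHS](coordE c1 a).
  by elim/big_rec2: _ => [//|i x y _ ->]; congr pair => /=; rewrite scaler0 add0r.
have -> : \sum_i coord_fun c2 i b *: ((0, coord_vec c2 i) : V1 * V2) = (0, b).
  rewrite [in RHS](coordE c2 b).
  by elim/big_rec2: _ => [//|i x y _ ->]; congr pair => /=; rewrite scaler0 add0r.
by congr pair => /=; rewrite ?addr0 ?add0r.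
Qed.

Definition prod_coordinates : coordinates (V1 * V2)%type :=
  Coordinates pfun_continuous pfunE.
End Prod.

End Coordinates.

(** * Derivatives along lines; symmetry of second derivatives *)

Section Lines.
Context {R : realType}.

Section Generic.
Context {V W : normedModType R}.
Implicit Types (f : V -> W) (x v : V) (r : R).

Lemma line_is_derive f x v r : differentiable f (x + r *: v) ->
  is_derive r 1 (fun r => f (x + r *: v)) ('D_v f (x + r *: v)).
Proof.
move=> /diff_derivable - /(_ v) dv.
have E : (fun h : R => h^-1 *: (((fun r => f (x + r *: v)) \o shift r) (h *: 1)
    - f (x + r *: v)))
  = (fun h => h^-1 *: ((f \o shift (x + r *: v)) (h *: v) - f (x + r *: v))).
  by apply/funext => h; rewrite /= [h%:A]mulr1 scalerDl addrCA.
by split; rewrite /derivable /derive E.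
Qed.

Lemma derive_translate (b : V) f x v :
  'D_v (fun x => f (x + b)) x = 'D_v f (x + b).
Proof.
rewrite /derive; apply: congr1; apply: (congr1 (fun q => q @ 0^')).
by apply/funext => h /=; rewrite addrA.
Qed.

(** No differentiability is involved: both sides are the limit of the same difference
    quotients. *)
Lemma derive_comp_linear (U : normedModType R) (A : {linear V -> U}) (f : U -> W)
    x v : 'D_v (fun x => f (A x)) x = 'D_(A v) f (A x).
Proof.
rewrite /derive; apply: congr1; apply: (congr1 (fun q => q @ 0^')).
by apply/funext => h /=; rewrite (linearD A) linearZ_LR.
Qed.

End Generic.

Lemma within_continuous_diff (f : R -> R) (a b : R) :
  (forall r, a <= r <= b -> differentiable f r) ->
  {within `[a, b], continuous f}.
Proof.
move=> df; apply: continuous_in_subspaceT => r /set_mem /=.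
by rewrite in_itv /= => /df /differentiable_continuous.
Qed.

Section Real.
Context {V : normedModType R}.
Implicit Types (f : V -> R) (x v : V).

Lemma mean_value_line f x v (t : R) : 0 < t ->
  (forall r, 0 <= r <= t -> differentiable f (x + r *: v)) ->
  exists2 r, 0 <= r <= t & f (x + t *: v) - f x = t * 'D_v f (x + r *: v).
Proof.
move=> t0 df; pose g r := f (x + r *: v).
have dg r : 0 <= r <= t -> is_derive r 1 g ('D_v f (x + r *: v)).
  by move=> /df; exact: line_is_derive.
have [||r] := @MVT _ g (fun r => 'D_v f (x + r *: v)) 0 t t0.
- by move=> r; rewrite in_itv /= => /andP[r0 rt]; apply: dg; rewrite !ltW.
- apply: within_continuous_diff => r rt.
  by apply/derivable1_diffP; have [] := dg r rt.
rewrite in_itv /= => /andP[r0 rt]; rewrite /g scale0r addr0 subr0 => e.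
by exists r; [rewrite !ltW|rewrite e mulrC].
Qed.

Lemma constant_line f x v :
  (forall r, 0 <= r <= 1 -> differentiable f (x + r *: v)) ->
  (forall r, 0 <= r <= 1 -> 'D_v f (x + r *: v) = 0) -> f (x + v) = f x.
Proof.
move=> df Df; have [r r01] := mean_value_line ltr01 df.
by rewrite Df // mulr0 scale1r => /eqP; rewrite subr_eq0 => /eqP.
Qed.

(** The mean value theorem applied twice to the second difference of f on a
    parallelogram. *)
Lemma mean_value_square f (U : set V) x v w (t : R) : 0 < t -> ck 2 U f ->
  (forall r s, 0 <= r <= t -> 0 <= s <= t -> U (x + r *: v + s *: w)) ->
  exists r s, [/\ 0 <= r <= t, 0 <= s <= t &
    f (x + t *: v + t *: w) - f (x + t *: v) - (f (x + t *: w) - f x) =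
    t * (t * 'D_w ('D_v f) (x + r *: v + s *: w))].
Proof.
move=> t0 cf Uxt; have [df cDf] := cf; have [dDf _] := cDf v.
pose g y := f (y + t *: w) - f y.
have tt : 0 <= t <= t by rewrite lexx ltW.
have zt : 0 <= (0 : R) <= t by rewrite lexx ltW.
have Ux r : 0 <= r <= t -> U (x + r *: v).
  by move=> /Uxt - /(_ 0 zt); rewrite scale0r addr0.
have dg r : 0 <= r <= t ->
    is_derive (x + r *: v) v g
      ('D_v f (x + r *: v + t *: w) - 'D_v f (x + r *: v)).
  move=> rt; apply: is_deriveB.
    have d := df _ (Uxt r t rt tt).
    split; last exact: derive_translate.
    apply: diff_derivable.
    by apply: (@differentiable_comp _ _ _ _ (+%R^~ (t *: w)) f).
  exact/derivableP/diff_derivable/df/Ux.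
have [r rt] : exists2 r, 0 <= r <= t & g (x + t *: v) - g x =
    t * ('D_v f (x + r *: v + t *: w) - 'D_v f (x + r *: v)).
  have [|r rt e] := @mean_value_line g x v t t0.
    move=> r rt; apply: differentiableB; last exact/df/Ux.
    apply: (@differentiable_comp _ _ _ _ (+%R^~ (t *: w)) f) => //.
    exact: df _ (Uxt r t rt tt).
  by exists r => //; rewrite e; have /@derive_val -> := dg r rt.
have [|s st ->] := @mean_value_line ('D_v f) (x + r *: v) w t t0.
  by move=> s st; apply: dDf; exact: Uxt.
by move=> e; exists r, s; split.
Qed.

(** The second difference is symmetric in v and w; both iterated derivatives are its
    limit on small parallelograms. *)
Lemma derive_commute f (U : set V) x v w : open U -> U x -> ck 3 U f ->
  'D_v ('D_w f) x = 'D_w ('D_v f) x.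
Proof.
move=> oU Ux cf; have [_ cDf] := cf.
have cont a b : {for x, continuous ('D_a ('D_b f))}.
  have [_ /(_ a) [d _]] := cDf b.
  exact: differentiable_continuous (d _ Ux).
apply/eqP; rewrite -subr_eq0 -normr_eq0 eq_le normr_ge0 andbT.
apply/ler_addgt0Pl => e e0; rewrite addr0.
have e2 : 0 < e / 2 by rewrite divr_gt0.
have NU : nbhs x U by exact: open_nbhs_nbhs.
have near a b : exists2 d, 0 < d & forall y, `|x - y| < d ->
    U y /\ `|'D_b ('D_a f) x - 'D_b ('D_a f) y| < e / 2.
  have /cvgrPdist_lt/(_ _ e2) H := cont b a.
  have : nbhs x (U `&` [set y | `|'D_b ('D_a f) x - 'D_b ('D_a f) y| < e / 2]).
    by apply: filterI.
  move=> /nbhs_ballP[d d0 Hd].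
  by exists d => // y xy; apply: Hd; rewrite -ball_normE.
have [d1 d10 H1] := near v w; have [d2 d20 H2] := near w v.
pose m := 1 + `|v| + `|w|.
have m0 : 0 < m by rewrite !ltr_pwDl // addr_ge0.
pose t := Num.min d1 d2 / m.
have t0 : 0 < t by rewrite divr_gt0 // lt_min d10 d20.
have tm (d r s : R) : Num.min d1 d2 <= d -> 0 <= r <= t -> 0 <= s <= t ->
    r * `|v| + s * `|w| < d.
  move=> dd /andP[r0 rt] /andP[s0 st].
  apply: lt_le_trans dd; rewrite -[ltRHS](divfK (lt0r_neq0 m0)) -/t /m.
  rewrite !mulrDr mulr1 -addrA; apply: ltr_pwDl => //.
  by apply: lerD; apply: ler_wpM2r.
have tv (d r s : R) : Num.min d1 d2 <= d -> 0 <= r <= t -> 0 <= s <= t ->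
    `|x - (x + r *: v + s *: w)| < d.
  move=> dd rt st; apply: le_lt_trans (tm _ _ _ dd rt st).
  rewrite -addrA opprD addrA subrr sub0r normrN (le_trans (ler_normD _ _)) //.
  by rewrite !normrZ !ger0_norm //; [case/andP: st|case/andP: rt].
have tw (d r s : R) : Num.min d1 d2 <= d -> 0 <= r <= t -> 0 <= s <= t ->
    `|x - (x + r *: w + s *: v)| < d.
  by move=> dd rt st; rewrite addrAC; apply: tv.
have l1 : Num.min d1 d2 <= d1 by rewrite ge_min lexx.
have l2 : Num.min d1 d2 <= d2 by rewrite ge_min lexx orbT.
have [|r [s [rt st E1]]] := @mean_value_square f U x v w t t0 (ckS cf).
  by move=> r s rt st; have [] := H1 _ (tv _ _ _ l1 rt st).
have [|r' [s' [rt' st' E2]]] := @mean_value_square f U x w v t t0 (ckS cf).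
  by move=> r' s' rt' st'; have [] := H2 _ (tw _ _ _ l2 rt' st').
have {E1 E2} E : 'D_w ('D_v f) (x + r *: v + s *: w) =
    'D_v ('D_w f) (x + r' *: w + s' *: v).
  apply: (mulfI (lt0r_neq0 t0)); apply: (mulfI (lt0r_neq0 t0)).
  apply: (etrans (esym E1)); apply: (etrans _ E2).
  have -> : x + t *: w + t *: v = x + t *: v + t *: w by rewrite addrAC.
  by move: (f _) (f _) (f _) (f _) => p1 p2 p3 p4; ring.
have [_ N1] := H1 _ (tv _ _ _ l1 rt st).
have [_ N2] := H2 _ (tw _ _ _ l2 rt' st').
have := ltrD N2 N1; rewrite -splitr => /ltW; apply: le_trans.
rewrite -[X in _ <= _ + X]normrN.
apply: le_trans (ler_normD _ _); rewrite E opprB.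
by rewrite addrA subrK.
Qed.

End Real.
End Lines.

(** * Charts of a manifold and of its tangent bundle *)

Section DiffTools.
Context {R : realType}.

Lemma diff_near (V W : normedModType R) (f g : V -> W) (x v : V) :
  (\forall z \near x, f z = g z) -> differentiable f x -> 'd g x v = 'd f x v.
Proof. by move=> fg /(diff_near_eq fg)[_ ->]. Qed.

Lemma diff_near_id (V : normedModType R) (f : V -> V) (x v : V) :
  (\forall z \near x, z = f z) -> 'd f x v = v.
Proof.
move=> fi; rewrite (diff_near v fi); last by have [] := is_diff_id x.
by rewrite diff_val.
Qed.

Section Pairs.
Context {V1 V2 W : normedModType R}.

Lemma derive_fst (F : V1 * V2 -> W) x y a :
  'D_(a, 0) F (x, y) = 'D_a (fun x => F (x, y)) x.
Proof.
rewrite /derive; apply: congr1; apply: (congr1 (fun q => q @ 0^')).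
apply/funext => h /=; congr (_ *: (F _ - _)).
by congr pair => /=; rewrite ?scaler0 ?add0r.
Qed.

Lemma derive_snd (F : V1 * V2 -> W) x y b :
  'D_(0, b) F (x, y) = 'D_b (fun y => F (x, y)) y.
Proof.
rewrite /derive; apply: congr1; apply: (congr1 (fun q => q @ 0^')).
apply/funext => h /=; congr (_ *: (F _ - _)).
by congr pair => /=; rewrite ?scaler0 ?add0r.
Qed.

Lemma near_fst (P : V1 -> Prop) (z : V1 * V2) :
  (\forall x \near z.1, P x) -> \forall w \near z, P w.1.
Proof. by move=> Pz; exact: (@cvg_fst _ _ (nbhs z.1) (nbhs z.2) _ P). Qed.

End Pairs.

Lemma smooth_near_fst (V1 V2 W : normedModType R) (c1 : coordinates V1)
    (f : V1 -> W) (z : V1 * V2) :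
  smooth_near f z.1 -> smooth_near (fun z => f z.1) z.
Proof.
move=> sf; apply: (smooth_near_comp c1 (f := f) (phi := fst)) => //.
apply: (smooth_near_linear (l := fst : {linear (V1 * V2)%type -> V1})
  (f := id)); first by move=> w; exact: cvg_fst.
exact: smooth_near_id.
Qed.

(** The differential, as a function of both the point and the vector, is a
    combination of derivatives along fixed vectors. *)
Lemma smooth_near_diff_app (V1 V W : normedModType R) (c1 : coordinates V1)
    (f : V1 -> W) (phi g : V -> V1) (z : V) :
  smooth_near f (phi z) -> smooth_near phi z -> smooth_near g z ->
  smooth_near (fun w => 'd f (phi w) (g w)) z.
Proof.
move=> sf sphi sg.
have S : smooth_near (fun w => \sum_i coord_fun c1 i (g w) *:
    'D_(coord_vec c1 i) f (phi w)) z.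
  apply: smooth_near_sum => i; apply: smooth_nearZ.
    exact: (smooth_near_linear (@coord_fun_continuous _ _ c1 i) sg).
  exact: (smooth_near_comp c1 (smooth_near_derive _ sf) sphi).
apply: smooth_near_eq S.
have phic := differentiable_continuous (smooth_near_diff sphi).
have D := phic _ (smooth_near_near sf).
apply: (@filterS _ (nbhs z) _ _ _ _ D) => w /smooth_near_diff df.
rewrite [in RHS](coordE c1 (g w)) linear_sum; apply: eq_bigr => i _.
by rewrite linearZ_LR deriveE.
Qed.

End DiffTools.

Section Atlas.
Context {R : realType} {N : Type} {V : normedModType R}.

(** The part of the notion of manifold that is inherited by the charts of the
    tangent bundle. *)
Record atlas (c : charts N V) : Prop := Atlas {
  atlas_mem : forall p, chart_dom c p p;
  atlasK : forall p q, chart_dom c p q -> ichart c p (chart c p q) = q;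
  atlas_near : forall p q, chart_dom c p q -> \forall x \near chart c p q,
    chart_dom c p (ichart c p x) /\ chart c p (ichart c p x) = x;
  atlas_near2 : forall p p' q, chart_dom c p q -> chart_dom c p' q ->
    \forall x \near chart c p q, chart_dom c p' (ichart c p x);
  atlas_smooth : forall p p' q, chart_dom c p q -> chart_dom c p' q ->
    smooth_near (chart c p' \o ichart c p) (chart c p q) }.

Variables (c : charts N V) (hc : atlas c).
Implicit Types p q : N.

(** The Jacobian of a change of charts; [pushvec c p q] is [transd c q p] at the
    point [chart c q q]. *)
Definition transd (c : charts N V) p q (x : V) : V -> V :=
  'd (chart c q \o ichart c p) x.

Lemma transd_id p q v : chart_dom c p q -> transd c p p (chart c p q) v = v.
Proof.
move=> pq; apply: diff_near_id; have H := atlas_near hc pq.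
by near=> x; have [_ /=] : chart_dom c p (ichart c p x) /\
  chart c p (ichart c p x) = x by near: x.
Unshelve. all: by end_near. Qed.

(** The cocycle identity of Jacobians, that is the chain rule. *)
Lemma transd_comp p p' p'' q v :
  chart_dom c p q -> chart_dom c p' q -> chart_dom c p'' q ->
  transd c p' p'' (chart c p' q) (transd c p p' (chart c p q) v) =
  transd c p p'' (chart c p q) v.
Proof.
move=> pq p'q p''q; rewrite /transd.
have d1 := smooth_near_diff (atlas_smooth hc pq p'q).
have e : (chart c p' \o ichart c p) (chart c p q) = chart c p' q.
  by rewrite /= (atlasK hc).
have d2 : differentiable (chart c p'' \o ichart c p')
    ((chart c p' \o ichart c p) (chart c p q)).
  by rewrite e; exact: smooth_near_diff (atlas_smooth hc p'q p''q).
have d12 := differentiable_comp d1 d2.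
rewrite [RHS](diff_near v _ d12); first by rewrite diff_comp //= (atlasK hc).
have H := atlas_near2 hc pq p'q.
by near=> x; rewrite /= (atlasK hc) //; near: x.
Unshelve. all: by end_near. Qed.

Lemma pushvecK p q v : chart_dom c p q ->
  transd c p q (chart c p q) (pushvec c p q v) = v.
Proof.
move=> pq; have qq := atlas_mem hc q.
exact: etrans (transd_comp v qq pq qq) (transd_id v qq).
Qed.

Lemma transdK p q v : chart_dom c p q ->
  pushvec c p q (transd c p q (chart c p q) v) = v.
Proof.
move=> pq; have qq := atlas_mem hc q.
exact: etrans (transd_comp v pq qq pq) (transd_id v pq).
Qed.

Lemma pushvec_trans p p' q v : chart_dom c p q -> chart_dom c p' q ->
  transd c p p' (chart c p q) (pushvec c p q v) = pushvec c p' q v.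
Proof. by move=> pq p'q; apply: transd_comp => //; exact: (atlas_mem hc). Qed.

Lemma pushvec_id p v : pushvec c p p v = v.
Proof. by apply: transd_id; exact: (atlas_mem hc). Qed.

Lemma near_ichart_center p : \forall x \near chart c p p,
  chart_dom c p (ichart c p x) /\ chart c p (ichart c p x) = x.
Proof. exact: (atlas_near hc (atlas_mem hc p)). Qed.

Lemma ichart_center p : ichart c p (chart c p p) = p.
Proof. exact: (atlasK hc (atlas_mem hc p)). Qed.

End Atlas.

Lemma manifold_atlas (R : realType) (n : nat) (M : topologicalType)
    (c : charts M 'rV[R]_n) : smooth_manifold c -> atlas c.
Proof.
move=> hM; split.
- exact: chart_dom_mem hM.
- exact: chartK hM.
- move=> p q pq.
  have I : (chart c p @` chart_dom c p) (chart c p q) by exists q.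
  have NI := open_nbhs_nbhs (conj (@chart_image_open _ _ _ _ hM p) I).
  apply: nearS NI => x [r pr <-].
  by rewrite (chartK hM).
- move=> p p' q pq p'q.
  have I : (chart c p @` chart_dom c p) (chart c p q) by exists q.
  have C := ichart_continuous hM I.
  apply: (C (chart_dom c p')); rewrite (chartK hM) //.
  exact: (open_nbhs_nbhs (conj (@chart_dom_open _ _ _ _ hM p') p'q)).
- by move=> p p' q pq p'q; apply: (transition_smooth hM); exists q.
Qed.

Section LinearComp.
Context {R : realType} {U V W : normedModType R}.

Lemma diff_linear_comp (l : {linear V -> W}) (lc : continuous l) (f : U -> V) x v :
  differentiable f x -> 'd (fun x => l (f x)) x v = l ('d f x v).
Proof.
have dl y : differentiable l y by exact: linear_differentiable.
by move=> df; rewrite (@diff_comp _ _ _ _ f l) //= diff_lin.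
Qed.

Lemma diff_comp_linear (l : {linear U -> V}) (lc : continuous l) (f : V -> W) x v :
  differentiable f (l x) -> 'd (fun x => f (l x)) x v = 'd f (l x) (l v).
Proof.
have dl y : differentiable l y by exact: linear_differentiable.
by move=> df; rewrite (@diff_comp _ _ _ _ l f) //= diff_lin.
Qed.

Lemma derive_linear (l : {linear U -> V}) (lc : continuous l) x v :
  'D_v l x = l v.
Proof.
have dl : differentiable l x by exact: linear_differentiable.
by rewrite deriveE // diff_lin.
Qed.

Lemma fst_continuous : continuous (fst : U * V -> U).
Proof. by move=> w; exact: cvg_fst. Qed.

Lemma snd_continuous : continuous (snd : U * V -> V).
Proof. by move=> w; exact: cvg_snd. Qed.

End LinearComp.

Section TangentAtlas.
Context {R : realType} {n : nat} {M : Type} (c : charts M 'rV[R]_n).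
Hypothesis hc : atlas c.
Local Notation E := 'rV[R]_n.
Local Notation tc := (tangent_charts c).
Local Notation TM := (M * 'rV[R]_n)%type.

Let coE : coordinates E := row_coordinates.
Definition tangent_coordinates : coordinates (E * E)%type :=
  prod_coordinates row_coordinates row_coordinates.
Let coEE := tangent_coordinates.

(** A change of charts of the tangent bundle is the tangent map of a change of
    charts of the base. *)
Lemma tangent_transition (u u' a : TM) : chart_dom tc u a -> chart_dom tc u' a ->
  \forall z \near chart tc u a,
    ((chart c u'.1 \o ichart c u.1) z.1, transd c u.1 u'.1 z.1 z.2) =
    (chart tc u' \o ichart tc u) z.
Proof.
move=> ua u'a.
have H := atlas_near hc ua; have H2 := atlas_near2 hc ua u'a.
have K := @near_fst R E E _ (chart tc u a) H.
have K2 := @near_fst R E E _ (chart tc u a) H2.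
apply: nearS2 K K2 => z /= [D e] D2.
congr pair; rewrite -[in LHS]e (_ : 'd _ _ _ = transd c u.1 (ichart c u.1 z.1)
  (chart c u.1 (ichart c u.1 z.1)) z.2); last by rewrite e.
exact/esym/(transd_comp hc z.2 D (atlas_mem hc _) D2).
Qed.

Lemma tangent_atlas : atlas tc.
Proof.
have near1 (u a : TM) : chart_dom tc u a -> \forall z \near chart tc u a,
    chart_dom c u.1 (ichart c u.1 z.1) /\ chart c u.1 (ichart c u.1 z.1) = z.1.
  move=> ua; exact: (@near_fst R E E _ (chart tc u a) (atlas_near hc ua)).
split.
- by move=> u; exact: (atlas_mem hc).
- move=> u [p y] /= up; rewrite (atlasK hc) //; congr pair.
  exact: pushvecK.
- move=> u a ua; apply: nearS (near1 u a ua) => z [D e]; split=> //=.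
  rewrite e [RHS]surjective_pairing; congr pair.
  by rewrite -[X in 'd _ X _]e; exact: transdK.
- move=> u u' a ua u'a.
  exact: (@near_fst R E E _ (chart tc u a) (atlas_near2 hc ua u'a)).
- move=> u u' a ua u'a; apply: smooth_near_eq (tangent_transition ua u'a) _.
  have S := atlas_smooth hc ua u'a.
  apply: smooth_near_pair; first exact: (smooth_near_fst coE).
  apply: (smooth_near_diff_app coE) => //.
    exact: (smooth_near_fst coE (f := id) (smooth_near_id _)).
  apply: (smooth_near_linear (l := snd : {linear (E * E)%type -> E}) (f := id)).
    by move=> w; exact: cvg_snd.
  exact: smooth_near_id.
Qed.

Lemma transd_tangent_fst (u u' a : TM) (w : E * E) :
  chart_dom tc u a -> chart_dom tc u' a ->
  (transd tc u u' (chart tc u a) w).1 =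
  transd c u.1 u'.1 (chart c u.1 a.1) w.1.
Proof.
move=> ua u'a; pose z := chart tc u a.
have S := smooth_near_diff (atlas_smooth tangent_atlas ua u'a).
have S1 : differentiable (chart c u'.1 \o ichart c u.1) z.1.
  exact: smooth_near_diff (atlas_smooth hc ua u'a).
have e1 := @diff_linear_comp _ _ _ _ (fst : {linear (E * E)%type -> E})
  fst_continuous _ z w S.
have e2 := @diff_comp_linear _ _ _ _ (fst : {linear (E * E)%type -> E})
  fst_continuous _ z w S1.
exact: etrans (esym e1) e2.
Qed.

(** Changes of charts of the tangent bundle are linear on the fibres. *)
Lemma transd_tangent_vert (u u' a : TM) (b : E) :
  chart_dom tc u a -> chart_dom tc u' a ->
  transd tc u u' (chart tc u a) (0, b) =
  (0, transd c u.1 u'.1 (chart c u.1 a.1) b).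
Proof.
move=> ua u'a; rewrite [LHS]surjective_pairing transd_tangent_fst //=.
congr pair; first exact: linear0.
have S := smooth_near_diff (atlas_smooth tangent_atlas ua u'a).
pose z := chart tc u a.
have e1 := @diff_linear_comp _ _ _ _ (snd : {linear (E * E)%type -> E})
  snd_continuous _ z (0, b) S.
apply: etrans (esym e1) _; rewrite -deriveE; last first.
  apply: (differentiable_comp S); apply: linear_differentiable.
  exact: snd_continuous.
rewrite -(@near_eq_derive _ _ _ (fun z => transd c u.1 u'.1 z.1 z.2)); last first.
  by apply: nearS (tangent_transition ua u'a) => z' e; exact: (congr1 snd e).
rewrite (surjective_pairing z) derive_snd /=.
apply: (@derive_linear _ _ _ ('d (chart c u'.1 \o ichart c u.1) (chart c u.1 a.1))).
exact/diff_continuous/smooth_near_diff/(atlas_smooth hc ua u'a).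
Qed.

End TangentAtlas.

(** * Sections of the pullback bundle in a chart *)

Section Sections.
Context {R : realType} {n : nat} {M : Type} (c : charts M 'rV[R]_n).
Hypothesis hc : atlas c.
Local Notation E := 'rV[R]_n.
Local Notation tc := (tangent_charts c).
Local Notation TM := (M * 'rV[R]_n)%type.
Let htc : atlas tc := tangent_atlas hc.
Let coE : coordinates E := row_coordinates.
Let coEE : coordinates (E * E)%type := tangent_coordinates.
Implicit Types (u a : TM) (Y : TM -> E).

Lemma tchart_center u : chart tc u u = (chart c u.1 u.1, u.2).
Proof. by congr pair; exact: pushvec_id. Qed.

Lemma rhoE u w : rho c u w = w.1.
Proof.
have NE : \forall z \near chart tc u u, z.1 = (chart c u.1 \o fst \o ichart tc u) z.
  have H := @near_fst R E E _ (chart tc u u) (near_ichart_center hc u.1).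
  by apply: nearS H => z [_ /esym].
rewrite /rho (diff_near w NE).
  by rewrite (@diff_lin _ _ _ (fst : {linear (E * E)%type -> E})) //;
    exact: fst_continuous.
exact/(@linear_differentiable _ _ _ (fst : {linear _ -> _}))/fst_continuous.
Qed.

Lemma vliftE u v : vlift c u v = (0, v).
Proof.
rewrite /vlift (_ : (fun y : E => _) = (fun y => (chart c u.1 u.1, y))); last first.
  by apply/funext => y; congr pair; exact: pushvec_id.
rewrite diff_pair //; congr pair; first by rewrite diff_val.
by rewrite diff_val.
Qed.

(** The sections and the vector fields that are constant in the chart at u; they
    contain local frames. *)
Definition frame u (v : E) : TM -> E :=
  fun a => transd c u.1 a.1 (chart c u.1 a.1) v.

Definition vframe u (w : E * E) : TM -> E * E :=
  fun a => transd tc u a (chart tc u a) w.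

Lemma psection_rep_center u Y : psection_rep c u Y (chart tc u u) = Y u.
Proof.
by rewrite /psection_rep (ichart_center htc) pushvec_id.
Qed.

Lemma vfield_rep_center u (X : TM -> E * E) :
  vfield_rep tc u X (chart tc u u) = X u.
Proof.
by rewrite /vfield_rep (ichart_center htc) pushvec_id.
Qed.

Lemma frame_center u v : frame u v u = v.
Proof. exact: (transd_id hc v (atlas_mem hc u.1)). Qed.

Lemma near_tangent u : \forall z \near chart tc u u,
  chart_dom tc u (ichart tc u z) /\ chart tc u (ichart tc u z) = z.
Proof. exact: (near_ichart_center htc). Qed.

Lemma psection_rep_frame u v :
  \forall z \near chart tc u u, psection_rep c u (frame u v) z = v.
Proof. by apply: nearS (near_tangent u) => z [D e]; exact: (transdK hc v D). Qed.

Lemma psection_rep_eta u :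
  \forall z \near chart tc u u, psection_rep c u Defs.eta z = z.2.
Proof. by apply: nearS (near_tangent u) => z [D e]; exact: (congr1 snd e). Qed.

Lemma vfield_rep_vframe u w :
  \forall z \near chart tc u u, vfield_rep tc u (vframe u w) z = w.
Proof. by apply: nearS (near_tangent u) => z [D e]; exact: (transdK htc w D). Qed.

Lemma smooth_frame u v : psection_smooth_at c (frame u v) u.
Proof.
apply: smooth_near_eq (smooth_near_cst v _).
by apply: nearS (psection_rep_frame u v) => z ->.
Qed.

Lemma smooth_vframe u w : vfield_smooth_at tc (vframe u w) u.
Proof.
apply: smooth_near_eq (smooth_near_cst w _).
by apply: nearS (vfield_rep_vframe u w) => z ->.
Qed.

Lemma smooth_near_snd (V1 V2 : normedModType R) (z : V1 * V2) :
  smooth_near (snd : V1 * V2 -> V2) z.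
Proof.
exact: (smooth_near_linear (@snd_continuous _ _ _) (smooth_near_id z)).
Qed.

Lemma smooth_eta u : psection_smooth_at c Defs.eta u.
Proof.
apply: smooth_near_eq (smooth_near_snd _).
by apply: nearS (psection_rep_eta u) => z ->.
Qed.

(** Smoothness at a point refers to the preferred chart of that point, and preferred
    charts at nearby points are unrelated.  The representations of a section in two
    charts differ by a change of variables and a Jacobian, which are smooth. *)
Lemma psection_smooth_transfer u u' a Y :
  chart_dom tc u a -> chart_dom tc u' a ->
  smooth_near (psection_rep c u Y) (chart tc u a) ->
  smooth_near (psection_rep c u' Y) (chart tc u' a).
Proof.
move=> ua u'a sY.
pose sg := chart tc u \o ichart tc u'.
have S : smooth_near (fun z => 'd (chart c u'.1 \o ichart c u.1) (z.1)
    (psection_rep c u Y z)) (chart tc u a).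
  apply: (smooth_near_diff_app coE) => //; first exact: (atlas_smooth hc ua u'a).
  exact: (smooth_near_linear (@fst_continuous _ _ _) (smooth_near_id _)).
have sS : smooth_near sg (chart tc u' a) by exact: (atlas_smooth htc u'a ua).
have e : sg (chart tc u' a) = chart tc u a.
  exact: (congr1 (chart tc u) (atlasK htc u'a)).
rewrite -e in S.
apply: smooth_near_eq (smooth_near_comp coEE S sS).
apply: nearS2 (atlas_near htc u'a) (atlas_near2 htc u'a ua) => z [D' e'] D.
have K := atlasK htc D.
have -> : psection_rep c u Y (sg z) =
    pushvec c u.1 (ichart tc u' z).1 (Y (ichart tc u' z)).
  by rewrite /psection_rep /sg [in LHS]/comp K.
exact: (pushvec_trans hc _ D D').
Qed.

Lemma psection_smooth_near u Y : psection_smooth_at c Y u ->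
  \forall z \near chart tc u u, psection_smooth_at c Y (ichart tc u z).
Proof.
move=> /smooth_near_near sY.
apply: nearS2 (near_tangent u) sY => z [D e] sz.
apply: (psection_smooth_transfer D (atlas_mem htc _)).
by rewrite e.
Qed.

Lemma near_neq0 (V : normedModType R) (y : V) : y != 0 ->
  \forall y' \near y, y' != 0.
Proof.
rewrite -normr_gt0 => y0.
have := @norm_continuous _ V y _ (open_nbhs_nbhs (conj (@open_gt _ 0) y0)).
by apply: nearS => y'; rewrite /= normr_gt0.
Qed.

Lemma near_slit u : slit u -> \forall z \near chart tc u u,
  slit (ichart tc u z).
Proof.
move=> u0.
have N2 : \forall z \near chart tc u u, z.2 != 0.
  have C := @snd_continuous R E E (chart tc u u).
  apply: (C [set y | y != 0]); rewrite tchart_center.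
  exact: (@near_neq0 E u.2 u0).
apply: nearS2 (near_tangent u) N2 => z [D e]; apply: contra_neq => e0.
apply: etrans (esym (congr1 snd e)) _.
rewrite [LHS]/(pushvec c u.1 (ichart tc u z).1 (ichart tc u z).2) e0.
exact: linear0.
Qed.

End Sections.

(** * Connections in a chart *)

Section LocalConnection.
Context {R : realType} {n : nat} {M : Type} (c : charts M 'rV[R]_n).
Hypothesis hc : atlas c.
Local Notation E := 'rV[R]_n.
Local Notation tc := (tangent_charts c).
Local Notation TM := (M * 'rV[R]_n)%type.
Let htc : atlas tc := tangent_atlas hc.
Variables (D : connection_op) (hD : linear_connection c D).
Implicit Types (u a : TM) (Y Z : TM -> E) (w : E * E) (v : E).

(** Christoffel symbols in the chart at u, for all directions of the slit bundle:
    those of the base for w = (x, 0), those of the fibre for w = (0, x). *)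
Definition christoffel u w v : E := D u w (frame c u v).
Local Notation G := christoffel.

Lemma psection_repZ u (f : TM -> R) Y z :
  psection_rep c u (fun a => f a *: Y a) z =
  f (ichart tc u z) *: psection_rep c u Y z.
Proof. exact: linearZ_LR. Qed.

Lemma psection_rep0 u z : psection_rep c u (fun=> 0) z = 0.
Proof. exact: linear0. Qed.

Lemma psection_smooth_eq u Y Z : psection_smooth_at c Y u ->
  (\forall z \near chart tc u u, Y (ichart tc u z) = Z (ichart tc u z)) ->
  psection_smooth_at c Z u.
Proof.
move=> sY YZ; apply: smooth_near_eq sY.
by apply: nearS YZ => z e; rewrite /psection_rep e.
Qed.

Lemma smooth_psection0 u : psection_smooth_at c (fun=> 0) u.
Proof.
apply: smooth_near_eq (smooth_near_cst 0 _).
by apply: nearS (near_tangent hc u) => z _; rewrite psection_rep0.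
Qed.

Lemma smooth_psection_sum (I : Type) (r : seq I) (f : I -> TM -> R)
    (Y : I -> TM -> E) u : (forall i, smooth_at tc (f i) u) ->
  (forall i, psection_smooth_at c (Y i) u) ->
  psection_smooth_at c (fun a => \sum_(i <- r) f i a *: Y i a) u.
Proof.
move=> sf sY.
have S := smooth_near_sum r (fun i => smooth_nearZ (sf i) (sY i)).
apply: smooth_near_eq S; apply: nearS (near_tangent hc u) => z _.
rewrite /psection_rep; apply: etrans (esym (linear_sum _ _ _ _)).
by apply: eq_bigr => i _; exact/esym/psection_repZ.
Qed.

Lemma conn0 u w : slit u -> D u w (fun=> 0) = 0.
Proof.
move=> u0; have s0 := smooth_psection0 u.
have := conn_additive hD u0 s0 s0 w; rewrite (_ : (fun a => 0 + 0) = fun=> 0).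
  by move=> /eqP; rewrite eq_sym -subr_eq0 addrK => /eqP.
by apply/funext => a; rewrite addr0.
Qed.

Lemma conn_near0 u w Y : slit u ->
  (\forall z \near chart tc u u, Y (ichart tc u z) = 0) -> D u w Y = 0.
Proof.
move=> u0 Y0; rewrite -[RHS](conn0 w u0); apply: (conn_local hD) => //.
  by apply: psection_smooth_eq (smooth_psection0 u) _; apply: nearS Y0.
exact: smooth_psection0.
Qed.

Lemma conn_sum (I : Type) (r : seq I) (f : I -> TM -> R)
    (Y : I -> TM -> E) u w : slit u -> (forall i, smooth_at tc (f i) u) ->
  (forall i, psection_smooth_at c (Y i) u) ->
  D u w (fun a => \sum_(i <- r) f i a *: Y i a) =
  \sum_(i <- r) (vderive tc u w (f i) *: Y i u + f i u *: D u w (Y i)).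
Proof.
move=> u0 sf sY; elim: r => [|i r IH].
  rewrite big_nil -[RHS](conn0 w u0); congr (D u w _).
  by apply/funext => a; rewrite big_nil.
rewrite big_cons -IH -(conn_leibniz hD u0 (sf i) (sY i)).
rewrite -(conn_additive hD u0); first last.
- exact: smooth_psection_sum.
- have := smooth_psection_sum [:: i] sf sY; congr psection_smooth_at.
  by apply/funext => a; rewrite big_seq1.
by congr (D u w _); apply/funext => a; rewrite big_cons.
Qed.

Lemma smooth_at_coord u Y (i : 'I_n) : psection_smooth_at c Y u ->
  let f := fun a => row_coord i (psection_rep c u Y (chart tc u a)) in
  smooth_at tc f u /\ forall w,
  vderive tc u w f = row_coord i ('d (psection_rep c u Y) (chart tc u u) w).
Proof.
move=> sY f.
have S := smooth_near_linear (@row_coord_continuous R n i) sY.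
have NE : \forall z \near chart tc u u,
    row_coord i (psection_rep c u Y z) = (f \o ichart tc u) z.
  by apply: nearS (near_tangent hc u) => z [_ e]; rewrite /f [in RHS]/comp e.
split; first exact: smooth_near_eq S.
move=> w; rewrite /vderive (diff_near w NE); last exact: smooth_near_diff S.
exact: (@diff_linear_comp _ _ _ _ _ (@row_coord_continuous R n i) _ _ w
  (smooth_near_diff sY)).
Qed.

(** The value of Y in the frame has the coordinates of Y in the chart. *)
Let frame_expansion u Y : \forall z \near chart tc u u,
  Y (ichart tc u z) =
  \sum_i row_coord i (psection_rep c u Y (chart tc u (ichart tc u z))) *:
    frame c u (delta_mx 0 i) (ichart tc u z).
Proof.
apply: nearS (near_tangent hc u) => z [D0 e].
set a := ichart tc u z.
have ea : chart tc u a = z by exact: e.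
rewrite ea -[LHS](pushvecK hc (Y a) D0).
rewrite [in LHS](row_coordE (pushvec c u.1 a.1 _)).
rewrite /transd linear_sum; apply: eq_bigr => i _.
exact: linearZ_LR.
Qed.

Let conn_expansion u w Y : slit u -> psection_smooth_at c Y u ->
  D u w Y = 'd (psection_rep c u Y) (chart tc u u) w +
    \sum_i row_coord i (Y u) *: G u w (delta_mx 0 i).
Proof.
move=> u0 sY.
have sf i := (smooth_at_coord i sY).1; have df i := (smooth_at_coord i sY).2 w.
have se i := smooth_frame hc u (delta_mx 0 i).
rewrite (conn_local hD u0 sY (smooth_psection_sum _ sf se) (frame_expansion u Y)).
rewrite conn_sum // big_split; congr (_ + _) => /=.
  rewrite [RHS]row_coordE; apply: eq_bigr => i _.
  by rewrite df (frame_center hc).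
by apply: eq_bigr => i _; rewrite (psection_rep_center hc).
Qed.

Lemma christoffel_sum u w v : slit u ->
  G u w v = \sum_i row_coord i v *: G u w (delta_mx 0 i).
Proof.
move=> u0; rewrite {1}/christoffel conn_expansion //; last exact: smooth_frame.
rewrite (frame_center hc).
have NE : \forall z \near chart tc u u, v = psection_rep c u (frame c u v) z.
  by apply: nearS (psection_rep_frame hc u v) => z ->.
rewrite (diff_near w NE); last exact: differentiable_cst.
by rewrite diff_cst add0r.
Qed.

(** This is the Leibniz rule applied to the expansion of Y in the frame of the sections
    that are constant in the chart. *)
Lemma connE u w Y : slit u -> psection_smooth_at c Y u ->
  D u w Y = 'd (psection_rep c u Y) (chart tc u u) w + G u w (Y u).
Proof. by move=> u0 sY; rewrite conn_expansion // -christoffel_sum. Qed.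

Lemma christoffelDr u w v v' : slit u -> G u w (v + v') = G u w v + G u w v'.
Proof.
move=> u0; rewrite !(christoffel_sum w _ u0) -big_split; apply: eq_bigr => i _.
by rewrite linearD scalerDl.
Qed.

Lemma christoffelZr u w (t : R) v : slit u -> G u w (t *: v) = t *: G u w v.
Proof.
move=> u0; rewrite !(christoffel_sum w _ u0) scaler_sumr; apply: eq_bigr => i _.
by rewrite linearZ_LR scalerA.
Qed.

Lemma christoffel_linearl u (t : R) w w' v : slit u ->
  G u (t *: w + w') v = t *: G u w v + G u w' v.
Proof. by move=> u0; apply: (conn_linear hD) => //; exact: smooth_frame. Qed.

Lemma christoffelDl u w w' v : slit u -> G u (w + w') v = G u w v + G u w' v.
Proof. by move=> u0; have := christoffel_linearl 1 w w' v u0; rewrite !scale1r. Qed.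

(** In a chart the fundamental field is the fibre coordinate. *)
Lemma conn_mapE u w : slit u -> conn_map D u w = w.2 + G u w u.2.
Proof.
move=> u0; rewrite /conn_map connE //; last exact: smooth_eta.
congr (_ + _).
have NE : \forall z \near chart tc u u, z.2 = psection_rep c u Defs.eta z.
  by apply: nearS (psection_rep_eta hc u) => z ->.
rewrite (diff_near w NE); last exact: smooth_near_diff (smooth_near_snd _).
by rewrite (@diff_lin _ _ _ (snd : {linear (E * E)%type -> E})) //;
  exact: snd_continuous.
Qed.

End LocalConnection.

(** * Horizontal lifts and torsion *)

Section SmoothMatrix.
Context {R : realType} {V : normedModType R}.

Lemma smooth_near_det m (A : V -> 'M[R]_m) z :
  (forall i j, smooth_near (fun x => A x i j) z) ->
  smooth_near (fun x => \det (A x)) z.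
Proof.
move=> sA; rewrite /determinant; apply: smooth_near_sum => s.
by apply: smooth_nearM; [exact: smooth_near_cst|exact: smooth_near_prod].
Qed.

Lemma smooth_near_row m (f : V -> 'rV[R]_m) z :
  (forall j, smooth_near (fun x => f x 0 j) z) -> smooth_near f z.
Proof.
move=> sf.
have S := smooth_near_sum (index_enum 'I_m)
  (fun j => smooth_nearZ (sf j) (smooth_near_cst (delta_mx 0 j : 'rV[R]_m) z)).
by apply: smooth_near_eq S; apply: nearW => x; rewrite [RHS]row_coordE.
Qed.

(** By Cramer's rule the solution is a quotient of polynomials in the coefficients of
    the system. *)
Lemma smooth_near_solve m (A : V -> 'M[R]_m) (f r : V -> 'rV[R]_m) z :
  (forall i j, smooth_near (fun x => A x i j) z) -> smooth_near r z ->
  A z \in unitmx -> (\forall x \near z, f x *m A x = r x) -> smooth_near f z.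
Proof.
move=> sA sr uA fA; pose d x := \det (A x).
have sd : smooth_near d z by exact: smooth_near_det.
have d0 : d z != 0 by move: uA; rewrite unitmxE unitfE.
have S : smooth_near (fun x => (d x)^-1 *: (r x *m \adj (A x))) z.
  apply: smooth_nearZ; first exact: smooth_near_inv.
  apply: smooth_near_row => j.
  apply: (@smooth_near_eq _ _ _ (fun x =>
    \sum_i row_coord i (r x) * ((-1) ^+ (j + i) *
      \det (row' j (col' i (A x)))))).
    by apply: nearW => x; rewrite mxE; apply: eq_bigr => i _; rewrite mxE.
  apply: smooth_near_sum => i; apply: smooth_nearM.
    exact: (smooth_near_linear (@row_coord_continuous R m i) sr).
  apply: smooth_nearM; first exact: smooth_near_cst.
  apply: smooth_near_det => i' j'.
  by apply: smooth_near_eq (sA (lift j i') (lift i j')); apply: nearW => x;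
    rewrite !mxE.
have N0 : \forall x \near z, d x != 0.
  have dc := differentiable_continuous (smooth_near_diff sd).
  exact: (dc _ (near_neq0 d0)).
apply: smooth_near_eq S; apply: nearS2 fA N0 => x <- dx.
by rewrite -mulmxA mul_mx_adj mul_mx_scalar scalerA mulVf // scale1r.
Qed.

End SmoothMatrix.

Section HorizontalLift.
Context {R : realType} {n : nat} {M : Type} (c : charts M 'rV[R]_n).
Hypothesis hc : atlas c.
Local Notation E := 'rV[R]_n.
Local Notation tc := (tangent_charts c).
Local Notation TM := (M * 'rV[R]_n)%type.
Let htc : atlas tc := tangent_atlas hc.
Variables (D : connection_op) (hD : linear_connection c D) (rD : regular c D).
Implicit Types (u a : TM) (X Y Z : TM -> E) (w : E * E) (v : E).

Lemma conn_map_linear u (t : R) w w' : slit u ->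
  conn_map D u (t *: w + w') = t *: conn_map D u w + conn_map D u w'.
Proof. by move=> u0; apply: (conn_linear hD u0); exact: smooth_eta. Qed.

Lemma conn_mapD u w w' : slit u ->
  conn_map D u (w + w') = conn_map D u w + conn_map D u w'.
Proof. by move=> u0; have := conn_map_linear 1 w w' u0; rewrite !scale1r. Qed.

Lemma conn_map0 u : slit u -> conn_map D u 0 = 0.
Proof.
move=> u0; have := conn_mapD 0 0 u0; rewrite addr0 => /eqP.
by rewrite eq_sym -subr_eq0 addrK => /eqP.
Qed.

Lemma conn_mapZ u (t : R) w : slit u ->
  conn_map D u (t *: w) = t *: conn_map D u w.
Proof.
by move=> u0; have := conn_map_linear t w 0 u0; rewrite conn_map0 // !addr0.
Qed.

(** The splitting into vertical and horizontal vectors makes rho an isomorphism from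
    the kernel of the connection map. *)
Lemma hlift_spec u v : slit u ->
  conn_map D u (hlift c D u v) = 0 /\ (hlift c D u v).1 = v.
Proof.
move=> u0; rewrite /hlift; case: xgetP => [w _ [Kw]|H].
  by rewrite rhoE.
have [a [b [ra Kb e]]] := (rD u0).1 (v, 0); case: (H b); split=> //.
move: ra; rewrite !rhoE // => ra.
by have := congr1 fst e; rewrite /= ra add0r.
Qed.

Lemma hlift_unique u v w : slit u -> conn_map D u w = 0 -> w.1 = v ->
  w = hlift c D u v.
Proof.
move=> u0 Kw wv; have [Kh hv] := hlift_spec v u0.
apply/eqP; rewrite -subr_eq0; apply/eqP; apply: (rD u0).2.
  by rewrite rhoE //= wv hv subrr.
by rewrite conn_mapD // Kw -scaleN1r conn_mapZ // Kh scaler0 addr0.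
Qed.

(** The connection map in the chart at u; its coefficients are smooth because they
    are covariant derivatives of the fundamental field along smooth vector
    fields. *)
Let Kz u w : E * E -> E := psection_rep c u (cov D (vframe c u w) Defs.eta).

Let Kz_smooth u w : slit u -> smooth_near (Kz u w) (chart tc u u).
Proof.
by move=> u0; apply: (conn_smooth hD u0); [exact: smooth_vframe|exact: smooth_eta].
Qed.

Let Kz_linear u z (t : R) w w' : slit (ichart tc u z) ->
  Kz u (t *: w + w') z = t *: Kz u w z + Kz u w' z.
Proof.
move=> z0; rewrite /Kz /psection_rep; set q := ichart tc u z.
have -> : cov D (vframe c u (t *: w + w')) Defs.eta q =
    t *: cov D (vframe c u w) Defs.eta q + cov D (vframe c u w') Defs.eta q.
  rewrite -[RHS](conn_map_linear t _ _ z0); congr (conn_map D q _).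
  exact: linearP.
exact: linearP.
Qed.

Let Kz_expansion u z x y : slit (ichart tc u z) ->
  Kz u (x, y) z = \sum_i x 0 i *: Kz u (delta_mx 0 i, 0) z
    + y *m \matrix_i Kz u (0, delta_mx 0 i) z.
Proof.
move=> z0.
have KD w w' : Kz u (w + w') z = Kz u w z + Kz u w' z.
  by have := Kz_linear 1 w w' z0; rewrite !scale1r.
have K0 : Kz u 0 z = 0.
  have := KD 0 0; rewrite addr0 => /eqP.
  by rewrite eq_sym -subr_eq0 addrK => /eqP.
have KZ t w : Kz u (t *: w) z = t *: Kz u w z.
  by have := Kz_linear t w 0 z0; rewrite K0 !addr0.
have Ksum (I : Type) (r : seq I) (F : I -> E * E) :
    Kz u (\sum_(i <- r) F i) z = \sum_(i <- r) Kz u (F i) z.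
  by elim: r => [|i r IH]; rewrite ?big_nil ?big_cons ?KD ?IH.
rewrite (pfunE row_coordinates row_coordinates (x, y)) Ksum big_sumType /=.
congr (_ + _); first by apply: eq_bigr => i _; rewrite KZ.
rewrite mulmx_sum_row; apply: eq_bigr => i _.
by rewrite KZ rowK.
Qed.

(** A vertical vector in the kernel of the connection map is zero by regularity. *)
Let Kz_unit u z : chart_dom tc u (ichart tc u z) -> slit (ichart tc u z) ->
  \matrix_i Kz u (0, delta_mx 0 i) z \in unitmx.
Proof.
move=> Dz z0; rewrite -row_free_unit; apply: inj_row_free => y.
have := Kz_expansion 0 y z0; rewrite big1 ?add0r; last first.
  by move=> i _; rewrite mxE scale0r.
move=> <-; rewrite /Kz /psection_rep; set q := ichart tc u z => e.
have e1 : conn_map D q (vframe c u (0, y) q) = 0.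
  rewrite -[LHS](pushvecK hc _ Dz) [X in transd _ _ _ _ X]e; exact: linear0.
have e2 : vframe c u (0, y) q = (0, transd c u.1 q.1 (chart c u.1 q.1) y).
  exact: (transd_tangent_vert hc y Dz (atlas_mem htc q)).
have r0 : rho c q (vframe c u (0, y) q) = 0 by rewrite e2 rhoE.
have e3 := congr1 snd ((rD z0).2 _ r0 e1); rewrite e2 /= in e3.
rewrite -[LHS](transdK hc y Dz) [X in pushvec _ _ _ X]e3; exact: linear0.
Qed.

(** In a chart the vertical component of a horizontal lift solves a linear system
    whose matrix is the restriction of the connection map to vertical vectors. *)
Lemma hlift_smooth u X : slit u -> psection_smooth_at c X u ->
  vfield_smooth_at tc (fhlift c D X) u.
Proof.
move=> u0 sX; pose b := vfield_rep tc u (fhlift c D X).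
have NS := near_slit hc u0; have ND := near_tangent hc u.
have b1 : \forall z \near chart tc u u, psection_rep c u X z = (b z).1.
  apply: nearS2 ND NS => z [Dz ez] z0.
  have [_ h1] := hlift_spec (X (ichart tc u z)) z0.
  rewrite /psection_rep -[X in pushvec _ _ _ X]h1; symmetry.
  exact: (transd_tangent_fst hc _ (atlas_mem htc _) Dz).
pose A z : 'M[R]_n := \matrix_i Kz u (0, delta_mx 0 i) z.
pose r z : E := - \sum_i psection_rep c u X z 0 i *: Kz u (delta_mx 0 i, 0) z.
have b2 : \forall z \near chart tc u u, (b z).2 *m A z = r z.
  apply: nearS2 ND NS => z [Dz ez] z0.
  have [K1 h1] := hlift_spec (X (ichart tc u z)) z0.
  have e : Kz u (b z) z = 0.
    rewrite /Kz /psection_rep /cov; set q := ichart tc u z.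
    have -> : vframe c u (b z) q = hlift c D q (X q) by exact: (pushvecK htc).
    by rewrite [X in pushvec _ _ _ X]K1; exact: linear0.
  have e1 : psection_rep c u X z = (b z).1.
    rewrite /psection_rep -[X in pushvec _ _ _ X]h1; symmetry.
    exact: (transd_tangent_fst hc _ (atlas_mem htc _) Dz).
  move: e; rewrite [b z]surjective_pairing Kz_expansion // => /eqP.
  by rewrite addrC addr_eq0 => /eqP ->; rewrite /r e1.
have s2 : smooth_near (fun z => (b z).2) (chart tc u u).
  apply: (smooth_near_solve _ _ _ b2).
  - move=> i j; have S := smooth_near_linear (@row_coord_continuous R n j)
      (Kz_smooth (0, delta_mx 0 i) u0).
    by apply: smooth_near_eq S; apply: nearS ND => z _; rewrite mxE.
  - apply: (@smooth_near_eq _ _ _ (fun z => (-1 : R) *: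
      \sum_i psection_rep c u X z 0 i *: Kz u (delta_mx 0 i, 0) z)).
      by apply: nearS ND => z _; rewrite scaleN1r.
    apply: smooth_nearZ; first exact: smooth_near_cst.
    apply: smooth_near_sum => i; apply: smooth_nearZ; last exact: Kz_smooth.
    exact: (smooth_near_linear (@row_coord_continuous R n i) sX).
  - apply: Kz_unit; rewrite (ichart_center htc) //; exact: (atlas_mem htc).
apply: smooth_near_eq (smooth_near_pair sX s2).
by apply: nearS b1 => z ->; rewrite -surjective_pairing.
Qed.

End HorizontalLift.

Section Torsion.
Context {R : realType} {n : nat} {M : Type} (c : charts M 'rV[R]_n).
Hypothesis hc : atlas c.
Local Notation E := 'rV[R]_n.
Local Notation tc := (tangent_charts c).
Local Notation TM := (M * 'rV[R]_n)%type.
Let htc : atlas tc := tangent_atlas hc.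
Variables (D : connection_op) (hD : linear_connection c D) (rD : regular c D).
Implicit Types (u a : TM) (X Y Z : TM -> E) (w : E * E) (v : E).
Local Notation G := (christoffel c D).

Lemma vfield_rep_fst u (W : TM -> E * E) X :
  (\forall z \near chart tc u u,
    frho c W (ichart tc u z) = X (ichart tc u z)) ->
  \forall z \near chart tc u u, psection_rep c u X z = (vfield_rep tc u W z).1.
Proof.
move=> WX; apply: nearS2 WX (near_tangent hc u) => z e [Dz _].
rewrite /psection_rep -e /frho rhoE //; symmetry.
exact: (transd_tangent_fst hc _ (atlas_mem htc _) Dz).
Qed.

(** In a chart rho is the first projection, so that only the base components of the
    vector fields contribute to rho of their bracket. *)
Lemma bracket_fst u (V W : TM -> E * E) X Y :
  vfield_smooth_at tc V u -> vfield_smooth_at tc W u ->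
  psection_smooth_at c X u -> psection_smooth_at c Y u ->
  (\forall z \near chart tc u u,
    frho c V (ichart tc u z) = X (ichart tc u z)) ->
  (\forall z \near chart tc u u,
    frho c W (ichart tc u z) = Y (ichart tc u z)) ->
  (bracket tc V W u).1 =
  'd (psection_rep c u Y) (chart tc u u) (V u) -
  'd (psection_rep c u X) (chart tc u u) (W u).
Proof.
move=> sV sW sX sY VX WY.
have dfst (V' : TM -> E * E) X' w : vfield_smooth_at tc V' u ->
    psection_smooth_at c X' u -> (\forall z \near chart tc u u,
    frho c V' (ichart tc u z) = X' (ichart tc u z)) ->
    ('d (vfield_rep tc u V') (chart tc u u) w).1 =
    'd (psection_rep c u X') (chart tc u u) w.
  move=> sV' sX' /vfield_rep_fst e.
  rewrite -(diff_near w e (smooth_near_diff sX')); symmetry.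
  exact: (@diff_linear_comp _ _ _ _ (fst : {linear (E * E)%type -> E})
    (@fst_continuous _ _ _) _ _ w (smooth_near_diff sV')).
have e1 := dfst W Y (V u) sW sY WY; have e2 := dfst V X (W u) sV sX VX.
apply: etrans (congr2 (fun a b : E => a - b) e1 e2).
exact: (raddfB (fst : {linear (E * E)%type -> E})).
Qed.

(** The derivatives of the components of X and Y in the covariant derivatives cancel
    with those in the bracket. *)
Lemma torsionE u (V W : TM -> E * E) X Y : slit u ->
  vfield_smooth_at tc V u -> vfield_smooth_at tc W u ->
  psection_smooth_at c X u -> psection_smooth_at c Y u ->
  (\forall z \near chart tc u u,
    frho c V (ichart tc u z) = X (ichart tc u z)) ->
  (\forall z \near chart tc u u,
    frho c W (ichart tc u z) = Y (ichart tc u z)) ->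
  torsion c D V W u = G u (V u) (Y u) - G u (W u) (X u).
Proof.
move=> u0 sV sW sX sY VX WY; rewrite /torsion rhoE // (bracket_fst sV sW sX sY) //.
have covE (V' : TM -> E * E) (W' : TM -> E * E) Y' : psection_smooth_at c Y' u ->
    (\forall z \near chart tc u u,
      frho c W' (ichart tc u z) = Y' (ichart tc u z)) ->
    cov D V' (frho c W') u =
    'd (psection_rep c u Y') (chart tc u u) (V' u) + G u (V' u) (Y' u).
  move=> sY' WY'; rewrite /cov -connE //; apply: (conn_local hD) => //.
  by apply: psection_smooth_eq sY' _; apply: nearS WY'.
rewrite (covE V W Y) // (covE W V X) //.
have cancel (p q r s : E) : p + r - (q + s) - (p - q) = r - s.
  by rewrite opprD addrACA [X in X - _]addrC addrK.
exact: cancel.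
Qed.

Lemma vfield_rep_fvlift u X : \forall z \near chart tc u u,
  vfield_rep tc u (fvlift c X) z = (0, psection_rep c u X z).
Proof.
apply: nearS (near_tangent hc u) => z [Dz _].
rewrite /vfield_rep /fvlift (vliftE hc).
exact: (transd_tangent_vert hc _ (atlas_mem htc _) Dz).
Qed.

Lemma fvlift_smooth u X : psection_smooth_at c X u ->
  vfield_smooth_at tc (fvlift c X) u.
Proof.
move=> sX; apply: smooth_near_eq (smooth_near_pair (smooth_near_cst 0 _) sX).
by apply: nearS (vfield_rep_fvlift u X) => z ->.
Qed.

Lemma frho_fvlift X a : frho c (fvlift c X) a = 0.
Proof. by rewrite /frho rhoE // /fvlift vliftE. Qed.

Lemma frho_fhlift X u : slit u -> \forall z \near chart tc u u,
  frho c (fhlift c D X) (ichart tc u z) = X (ichart tc u z).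
Proof.
move=> u0; apply: nearS (near_slit hc u0) => z z0.
rewrite /frho rhoE //; exact: (hlift_spec hc rD _ z0).2.
Qed.

(** A vertical lift has no base component. *)
Lemma hvtorsionE u X Y : slit u -> psection_smooth_at c X u ->
  psection_smooth_at c Y u -> hvtorsion c D X Y u = G u (0, X u) (Y u).
Proof.
move=> u0 sX sY.
rewrite /hvtorsion (@torsionE u _ _ (fun=> 0) Y) //.
- rewrite /fvlift vliftE // -[RHS]subr0; congr (_ - _).
  by rewrite -[X in G _ _ X](scale0r 0) christoffelZr // scale0r.
- exact: fvlift_smooth.
- exact: hlift_smooth.
- exact: smooth_psection0.
- by apply: nearS (near_tangent hc u) => z _; exact: frho_fvlift.
- exact: frho_fhlift.
Qed.

Lemma htorsionE u X Y : slit u -> psection_smooth_at c X u ->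
  psection_smooth_at c Y u -> htorsion c D X Y u =
  G u (hlift c D u (X u)) (Y u) - G u (hlift c D u (Y u)) (X u).
Proof.
move=> u0 sX sY; rewrite /htorsion (@torsionE u _ _ X Y) //.
- exact: hlift_smooth.
- exact: hlift_smooth.
- exact: frho_fhlift.
- exact: frho_fhlift.
Qed.

End Torsion.

(** * The Finsler metric in a chart *)

Section Metric.
Context {R : realType} {n : nat} {M : Type} (c : charts M 'rV[R]_n).
Hypothesis hc : atlas c.
Local Notation E := 'rV[R]_n.
Local Notation tc := (tangent_charts c).
Local Notation TM := (M * 'rV[R]_n)%type.
Let htc : atlas tc := tangent_atlas hc.
Let coE : coordinates E := row_coordinates.
Let coEE : coordinates (E * E)%type := tangent_coordinates.
Variables (L : TM -> R) (hL : finsler c L).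
Implicit Types (u a : TM) (X Y Z : TM -> E) (v : E).
Local Notation g := (finsler_metric L).

(** The coefficients of the Finsler metric in the chart at u.  They are taken as
    derivatives of L ^ 2 in the chart to be differentiable in the base directions
    too. *)
Definition local_metric u v w : E * E -> R := fun z =>
  2^-1 * 'D_(0, v) ('D_(0, w) (fun z => L (ichart tc u z) ^+ 2)) z.

(** On a fibre a chart is a linear map, with which directional derivatives commute
    without any smoothness of L. *)
Lemma local_metricE u v w z :
  local_metric u v w z = g (ichart tc u z)
    (transd c u.1 (ichart tc u z).1 z.1 v) (transd c u.1 (ichart tc u z).1 z.1 w).
Proof.
case: z => x y; apply: (congr1 (fun t => 2^-1 * t)).
set q := ichart c u.1 x; pose A := 'd (chart c q \o ichart c u.1) x.
pose h y := L (q, y) ^+ 2.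
have e1 : (fun y => 'D_(0, w) (fun z => L (ichart tc u z) ^+ 2) (x, y)) =
    fun y => ('D_(A w) h) (A y).
  apply/funext => y'; apply: etrans (derive_snd _ _ _ _) _.
  exact: (derive_comp_linear A h y' w).
apply: etrans (derive_snd _ _ _ _) _; rewrite e1.
exact: (derive_comp_linear A ('D_(A w) h) y v).
Qed.

Lemma near_frame u v : \forall z \near chart tc u u,
  frame c u v (ichart tc u z) = transd c u.1 (ichart tc u z).1 z.1 v.
Proof.
apply: nearS (near_tangent hc u) => z [_ e].
exact: (congr1 (fun x => transd c u.1 (ichart tc u z).1 x v) (congr1 fst e)).
Qed.

Lemma local_metric_center u v w : local_metric u v w (chart tc u u) = g u v w.
Proof.
rewrite local_metricE (ichart_center htc).
by rewrite [X in g u X _](frame_center hc u v) [X in g u _ X](frame_center hc u w).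
Qed.

Lemma smooth_local_metric u v w : slit u ->
  smooth_near (local_metric u v w) (chart tc u u).
Proof.
move=> u0; have sL := finsler_smooth hL u0.
have sL2 : smooth_near (fun z => L (ichart tc u z) ^+ 2) (chart tc u u).
  exact: (smooth_nearM sL sL).
apply: smooth_nearM; first exact: smooth_near_cst.
exact/smooth_near_derive/smooth_near_derive.
Qed.

Section Fibre.
Variables (u : TM) (u0 : slit u).

Let sL2 : smooth_near (fun z => L (ichart tc u z) ^+ 2) (chart tc u u).
Proof. have sL := finsler_smooth hL u0; exact: (smooth_nearM sL sL). Qed.

Lemma metricC v w : g u v w = g u w v.
Proof.
rewrite -!local_metric_center; apply: (congr1 (fun t => 2^-1 * t)).
have /smooth_nearP[U [oU Uz sU]] := sL2.
exact: derive_commute oU Uz (sU 3%N).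
Qed.

Lemma metric_linearl (t : R) v v' w : g u (t *: v + v') w = t * g u v w + g u v' w.
Proof.
rewrite -!local_metric_center /local_metric.
have d := smooth_near_diff (smooth_near_derive (0, w) sL2).
rewrite !deriveE // mulrCA -mulrDr; congr (_ * _).
rewrite -[X in _ = X + _]linearZ_LR -linearD; congr ('d _ _ _).
by congr pair => /=; rewrite ?scaler0 ?addr0.
Qed.

Lemma metricDl v v' w : g u (v + v') w = g u v w + g u v' w.
Proof. by have := metric_linearl 1 v v' w; rewrite scale1r mul1r. Qed.

Lemma metric0l w : g u 0 w = 0.
Proof.
have := metricDl 0 0 w; rewrite addr0 => /eqP.
by rewrite eq_sym -subr_eq0 addrK => /eqP.
Qed.

Lemma metricZl (t : R) v w : g u (t *: v) w = t * g u v w.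
Proof. by have := metric_linearl t v 0 w; rewrite metric0l !addr0. Qed.

Lemma metricDr w v v' : g u w (v + v') = g u w v + g u w v'.
Proof. by rewrite !(metricC w) metricDl. Qed.

Lemma metricZr (t : R) w v : g u w (t *: v) = t * g u w v.
Proof. by rewrite !(metricC w) metricZl. Qed.

Lemma metricNl v w : g u (- v) w = - g u v w.
Proof. by rewrite -scaleN1r metricZl mulN1r. Qed.

Lemma metric_sumr (I : Type) (r : seq I) w (F : I -> E) :
  g u w (\sum_(i <- r) F i) = \sum_(i <- r) g u w (F i).
Proof.
elim: r => [|i r IH]; last by rewrite !big_cons metricDr IH.
by rewrite !big_nil metricC metric0l.
Qed.

Lemma metric_nondegenerate v : (forall w, g u v w = 0) -> v = 0.
Proof.
move=> H; apply/eqP/negPn/negP => v0.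
by have := finsler_posdef hL u0 v0; rewrite H ltxx.
Qed.

End Fibre.

End Metric.

Section MetricFibre.
Context {R : realType} {n : nat} {M : Type} (c : charts M 'rV[R]_n).
Hypothesis hc : atlas c.
Local Notation E := 'rV[R]_n.
Local Notation tc := (tangent_charts c).
Local Notation TM := (M * 'rV[R]_n)%type.
Let htc : atlas tc := tangent_atlas hc.
Let coE : coordinates E := row_coordinates.
Let coEE : coordinates (E * E)%type := tangent_coordinates.
Variables (L : TM -> R) (hL : finsler c L).
Implicit Types (u a : TM) (X Y Z : TM -> E) (v w : E).
Local Notation g := (finsler_metric L).

Lemma ichart_fibre u y : ichart tc u (chart c u.1 u.1, y) = (u.1, y).
Proof.
have := ichart_center htc (u.1, y).
by rewrite tchart_center.
Qed.

Lemma smooth_near_pairr (V1 V2 W : normedModType R) (c12 : coordinates (V1 * V2)%type)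
    (F : V1 * V2 -> W) x y :
  smooth_near F (x, y) -> smooth_near (fun y => F (x, y)) y.
Proof.
move=> sF; apply: (smooth_near_comp c12 (f := F) (phi := fun y => (x, y))) => //.
by apply: smooth_near_pair; [exact: smooth_near_cst|exact: smooth_near_id].
Qed.

Lemma smooth_fibre u : slit u -> smooth_near (fun y => L (u.1, y) ^+ 2) u.2.
Proof.
move=> u0; have := finsler_smooth hL u0.
rewrite /smooth_at tchart_center // => sL.
have sL2 := smooth_near_pairr coEE (smooth_nearM sL sL).
apply: smooth_near_eq sL2; apply: nearT => y.
by rewrite /comp ichart_fibre -expr2.
Qed.

(** L ^ 2 is homogeneous of degree 2, so that its second derivatives are homogeneous
    of degree 0. *)
Lemma metric_homogeneous p (y : E) (t : R) v w : y != 0 -> 0 < t ->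
  g (p, t *: y) v w = g (p, y) v w.
Proof.
move=> y0 t0; have tn0 := lt0r_neq0 t0.
have u0 : slit (p, y) by [].
have ty0 : slit (p, t *: y) by rewrite /slit /= scaler_eq0 negb_or tn0.
pose h y := L (p, y) ^+ 2.
have sh : smooth_near h y by exact: (smooth_fibre u0).
have eh : (fun y => h (t *: y)) = (t ^+ 2) *: h.
  by apply/funext => y'; rewrite /h (finsler_homogeneous hL) // exprMn.
have e1 : 'D_(t *: v) ('D_(t *: w) h) (t *: y) = t ^+ 2 * 'D_v ('D_w h) y.
  have l1 x w' (f : E -> R) := @derive_comp_linear _ _ _ _
    ( *:%R t : {linear E -> E}) f x w'.
  apply: etrans (esym (l1 _ _ _)) _.
  rewrite (_ : (fun y => 'D_(t *: w) h (t *: y)) = 'D_w (fun y => h (t *: y)));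
    last by apply/funext => y'; exact: (esym (l1 _ _ _)).
  rewrite eh; apply: (@etrans _ _ ('D_v ((t ^+ 2) *: ('D_w h)) y)).
    apply: near_eq_derive; apply: nearS (smooth_near_near sh) => y' sy'.
    exact/deriveZ/diff_derivable/smooth_near_diff.
  exact/deriveZ/diff_derivable/smooth_near_diff/smooth_near_derive.
have e2 : t * (t * g (p, t *: y) v w) = t * (t * g (p, y) v w).
  have a1 := metricZl hc hL ty0 t v (t *: w).
  have a2 := metricZr hc hL ty0 t v w.
  have a3 : g (p, t *: y) (t *: v) (t *: w) = t * (t * g (p, y) v w).
    apply: etrans (congr1 (fun r => 2^-1 * r) e1) _.
    by rewrite mulrCA expr2 -mulrA.
  exact: etrans (etrans (congr1 (fun r => t * r) (esym a2)) (esym a1)) a3.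
by apply: (mulfI tn0); apply: (mulfI tn0).
Qed.

Lemma local_metric_fibre u y v w :
  local_metric c L u v w (chart c u.1 u.1, y) = g (u.1, y) v w.
Proof.
have := local_metric_center hc L (u.1, y) v w.
by rewrite tchart_center.
Qed.

Lemma metric_rep u Y Z : \forall z \near chart tc u u,
  g (ichart tc u z) (Y (ichart tc u z)) (Z (ichart tc u z)) =
  local_metric c L u (psection_rep c u Y z) (psection_rep c u Z z) z.
Proof.
have frameK X : \forall z \near chart tc u u,
    transd c u.1 (ichart tc u z).1 z.1 (psection_rep c u X z) = X (ichart tc u z).
  apply: nearS (near_tangent hc u) => z [Dz e].
  apply: etrans (pushvecK hc (X (ichart tc u z)) Dz).
  exact: (congr1 (fun x => transd c u.1 (ichart tc u z).1 x _) (esym (congr1 fst e))).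
apply: nearS2 (frameK Y) (frameK Z) => z eY eZ.
by rewrite local_metricE eY eZ.
Qed.

Lemma local_metric_expansion u z v w : slit (ichart tc u z) ->
  local_metric c L u v w z = \sum_i row_coord i v *:
    \sum_j row_coord j w *: local_metric c L u (delta_mx 0 i) (delta_mx 0 j) z.
Proof.
move=> z0; rewrite local_metricE; set A := transd c u.1 _ _.
have Al s : A s = \sum_i row_coord i s *: A (delta_mx 0 i).
  rewrite [in LHS](row_coordE s) /A /transd linear_sum.
  by apply: eq_bigr => i _; exact: linearZ_LR.
rewrite (Al v) (metricC hc hL z0) (metric_sumr hc hL z0); apply: eq_bigr => i _.
rewrite (metricZr hc hL z0) (metricC hc hL z0).
rewrite (Al w) (metric_sumr hc hL z0); apply: (congr1 (fun r => _ * r)).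
by apply: eq_bigr => j _; rewrite (metricZr hc hL z0) local_metricE.
Qed.

(** The metric is bilinear, so g(Y, Z) is a polynomial in the coordinates of Y and Z
    and in the coefficients of the metric. *)
Lemma smooth_metric u Y Z : slit u ->
  psection_smooth_at c Y u -> psection_smooth_at c Z u ->
  smooth_at tc (fun a => g a (Y a) (Z a)) u.
Proof.
move=> u0 sY sZ.
have S : smooth_near (fun z => \sum_i row_coord i (psection_rep c u Y z) *:
    \sum_j row_coord j (psection_rep c u Z z) *:
      local_metric c L u (delta_mx 0 i) (delta_mx 0 j) z) (chart tc u u).
  apply: smooth_near_sum => i; apply: smooth_nearZ.
    exact: (smooth_near_linear (@row_coord_continuous R n i) sY).
  apply: smooth_near_sum => j; apply: smooth_nearZ.
    exact: (smooth_near_linear (@row_coord_continuous R n j) sZ).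
  exact: smooth_local_metric.
apply: smooth_near_eq S; apply: nearS2 (near_slit hc u0) (metric_rep u Y Z) => z z0 e.
by rewrite /comp e (local_metric_expansion _ _ z0).
Qed.

End MetricFibre.

Section CartanConnection.
Context {R : realType} {n : nat} {M : Type} (c : charts M 'rV[R]_n).
Hypothesis hc : atlas c.
Local Notation E := 'rV[R]_n.
Local Notation tc := (tangent_charts c).
Local Notation TM := (M * 'rV[R]_n)%type.
Let htc : atlas tc := tangent_atlas hc.
Variables (L : TM -> R) (hL : finsler c L).
Variables (D : connection_op) (hD : cartan_connection c L D).
Let lD := cartan_linear hD.
Let rD := cartan_regular hD.
Implicit Types (u a : TM) (X Y Z : TM -> E) (v w : E).
Local Notation g := (finsler_metric L).
Local Notation G := (christoffel c D).

(** The metric is parallel; here it is evaluated on constant sections. *)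
Lemma christoffel_metric u W v w : slit u ->
  'd (local_metric c L u v w) (chart tc u u) W =
  g u (G u W v) w + g u v (G u W w).
Proof.
move=> u0.
have NE : \forall z \near chart tc u u, local_metric c L u v w z =
    ((fun a => g a (frame c u v a) (frame c u w a)) \o ichart tc u) z.
  apply: nearS2 (near_frame hc u v) (near_frame hc u w) => z ev ew.
  by rewrite /comp ev ew local_metricE.
have d := smooth_near_diff (smooth_local_metric hL v w u0).
apply: etrans (esym (diff_near W NE d)) _.
have := cartan_metrical hD u0 (smooth_frame hc u v) (smooth_frame hc u w) W.
by rewrite !(frame_center hc).
Qed.

(** The vertical Christoffel symbols are the torsion T; lowered by g they are the
    Cartan tensor, symmetric in its last two arguments by definition of the Cartan
    connection. *)
Lemma christoffel_vert_sym u (x : E) v w : slit u ->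
  g u (G u (0, x) v) w = g u (G u (0, x) w) v.
Proof.
move=> u0; have sf := smooth_frame hc u.
have := cartan_hvtorsion hD u0 (sf x) (sf v) (sf w).
have e1 := hvtorsionE hc lD rD u0 (sf x) (sf v).
have e2 := hvtorsionE hc lD rD u0 (sf x) (sf w).
have -> := frame_center hc u v; have -> := frame_center hc u w.
move: e1 e2; have -> := frame_center hc u x; have -> := frame_center hc u v.
by have -> := frame_center hc u w; move=> -> ->.
Qed.

(** Up to a factor the Cartan tensor is the vertical derivative of the metric: the
    two terms given by the parallelism of g are equal by symmetry. *)
Lemma diff_metric_vert u (x : E) v w : slit u ->
  'd (local_metric c L u v w) (chart tc u u) (0, x) = 2 * g u (G u (0, x) v) w.
Proof.
move=> u0; apply: etrans (christoffel_metric (0, x) v w u0) _.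
have e := etrans (metricC hc hL u0 v (G u (0, x) w)) (christoffel_vert_sym x w v u0).
by apply: etrans (congr1 (fun r => _ + r) e) _; rewrite mulr2n mulrDl mul1r.
Qed.

(** Both sides are third derivatives of L ^ 2 along a fibre. *)
Lemma diff_metric_vert_sym u (x : E) v w : slit u ->
  'd (local_metric c L u v w) (chart tc u u) (0, x) =
  'd (local_metric c L u x w) (chart tc u u) (0, v).
Proof.
move=> u0; have sL := finsler_smooth hL u0.
have sF := smooth_near_derive (0, w) (smooth_nearM sL sL).
have lm s t : 'd (local_metric c L u s w) (chart tc u u) (0, t) =
    2^-1 * 'D_(0, t) ('D_(0, s) ('D_(0, w)
      (fun z => L (ichart tc u z) * L (ichart tc u z)))) (chart tc u u).
  rewrite -deriveE; last exact/smooth_near_diff/smooth_local_metric.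
  exact/(deriveZ (f := 'D_(0, s) _) 2^-1)/diff_derivable/smooth_near_diff/smooth_near_derive.
apply: etrans (lm v x) _; apply: etrans _ (esym (lm x v)).
apply: (congr1 (fun r => 2^-1 * r)).
have /smooth_nearP[U [oU Uz sU]] := sF.
exact: derive_commute oU Uz (sU 3%N).
Qed.

End CartanConnection.

(** * Functions along the fibres of the tangent bundle *)

Section Segments.
Context {R : realType} {V : normedModType R}.

(** The ball of centre y and radius |y| avoids the origin. *)
Lemma near_segment (y : V) : y != 0 -> \forall y' \near y,
  forall r : R, 0 <= r <= 1 -> y + r *: (y' - y) != 0.
Proof.
rewrite -normr_gt0 => y0; have B := nbhsx_ballx y `|y| y0.
apply: nearS B => y'; rewrite -ball_normE /= => yy' r /andP[r0 r1].
apply/eqP => e; have : `|y| <= `|y - y'|.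
  have ye : y = r *: (y - y').
    by apply/eqP; rewrite -subr_eq0 -scalerN opprB e.
  rewrite [in leLHS]ye.
  by rewrite normrZ ger0_norm // ler_piMl.
by rewrite leNgt yy'.
Qed.

Lemma ball_segment (a y y' : V) (e r : R) : ball a e y -> ball a e y' ->
  0 <= r <= 1 -> ball a e (y + r *: (y' - y)).
Proof.
rewrite -!ball_normE /= => ya y'a /andP[r0 r1].
have -> : a - (y + r *: (y' - y)) = (1 - r) *: (a - y) + r *: (a - y').
  rewrite scalerBl scale1r -addrA [- _ + _]addrC -scalerBr opprB.
  by rewrite [a - y' + _]addrC subrKA opprD addrA -scalerN opprB.
apply: le_lt_trans (ler_normD _ _) _.
rewrite !normrZ !ger0_norm ?subr_ge0 //.
have e0 : 0 < e by apply: le_lt_trans ya.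
have [->|rn0] := eqVneq r 0; first by rewrite subr0 mul1r mul0r addr0.
have -> : e = (1 - r) * e + r * e by rewrite -mulrDl subrK mul1r.
apply: ler_ltD.
  by rewrite ler_wpM2l ?subr_ge0// ltW.
by rewrite ltr_pM2l // lt0r rn0.
Qed.

(** Otherwise the mean of phi 0 and phi 1 would be a third value. *)
Lemma two_valued_constant (phi : R -> R) (k l : R) :
  {within `[0, 1], continuous phi} ->
  (forall r, 0 <= r <= 1 -> phi r = k \/ phi r = l) -> phi 0 = phi 1.
Proof.
move=> cphi kl; apply/eqP/negPn/negP => ne.
have [|r r01 e] := @IVT R phi 0 1 ((phi 0 + phi 1) / 2) ler01 cphi.
  rewrite ge_min le_max; move: (phi 0) (phi 1) => a b.
  by case: (lerP a b) => ab; apply/andP; split; apply/orP; [left|right|right|left]; lra.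
have {}r01 : 0 <= r <= 1 by move: r01; rewrite in_itv.
have z01 : 0 <= (0 : R) <= 1 by rewrite lexx ler01.
have o01 : 0 <= (1 : R) <= 1 by rewrite lexx ler01.
move/eqP: ne; have := kl _ r01; rewrite e.
by case: (kl _ z01) (kl _ o01) => -> [] -> [] H ne; apply: ne; lra.
Qed.

Lemma half_line_limit (phi : V -> R) (x y : V) (k : R) :
  {for x, continuous phi} -> (forall t, 0 < t -> phi (x + t *: y) = k) ->
  phi x = k.
Proof.
move=> cphi H; apply/eqP; rewrite -subr_eq0 -normr_eq0 eq_le normr_ge0 andbT.
apply/ler_addgt0Pl => e e0; rewrite addr0.
have /cvgrPdist_lt/(_ _ e0) N := cphi.
have /nbhs_ballP[d /= d0 Hd] := N.
pose t := d / (1 + `|y|).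
have m0 : 0 < 1 + `|y| by rewrite ltr_pwDl.
have t0 : 0 < t by rewrite divr_gt0.
have B : ball x d (x + t *: y).
  rewrite -ball_normE /= opprD addrA subrr sub0r normrN normrZ gtr0_norm //.
  by rewrite -[ltRHS](divfK (lt0r_neq0 m0)) -/t ltr_pM2l // ltrDr.
by have := Hd _ B; rewrite /= H // => /ltW.
Qed.

End Segments.

Section Fibres.
Context {R : realType} {n : nat} {M : Type} (c : charts M 'rV[R]_n).
Hypothesis hc : atlas c.
Local Notation E := 'rV[R]_n.
Local Notation tc := (tangent_charts c).
Local Notation TM := (M * 'rV[R]_n)%type.
Let htc : atlas tc := tangent_atlas hc.
Implicit Types (u a : TM) (f : TM -> R) (v w y : E).

(** Segments through the origin are excluded: a fibre of the slit bundle may be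
    disconnected. *)
Definition fibre_constant (T : Type) (f : TM -> T) := forall p y v,
  (forall r : R, 0 <= r <= 1 -> y + r *: v != 0) -> f (p, y + v) = f (p, y).

Lemma differentiable_fibre (W : normedModType R) (F : E * E -> W) x y :
  differentiable F (x, y) -> differentiable (fun y => F (x, y)) y.
Proof.
by move=> dF; apply: (@differentiable_comp _ _ _ _ (fun y => (x, y)) F).
Qed.

Lemma fibre_constantP f :
  (forall u, slit u -> differentiable (f \o ichart tc u) (chart tc u u)) ->
  (forall u b, slit u -> vderive tc u (0, b) f = 0) -> fibre_constant f.
Proof.
move=> df Df p y v yv.
have E1 : (fun y => f (p, y)) =
    fun y => (f \o ichart tc (p, y)) (chart c p p, y).
  by apply/funext => y'; rewrite /comp (ichart_fibre hc (p, y')).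
have d r : 0 <= r <= 1 -> differentiable (f \o ichart tc (p, y + r *: v))
    (chart c p p, y + r *: v).
  by move=> r01; have := df (p, y + r *: v) (yv r r01); rewrite tchart_center.
apply: (@constant_line _ _ (fun y => f (p, y))) => r r01.
  rewrite E1; exact: (@differentiable_fibre _ (f \o ichart tc (p, y)) _ _ (d r r01)).
rewrite E1; apply: etrans (esym (derive_snd (f \o ichart tc (p, y)) _ _ _)) _.
rewrite deriveE; last exact: d.
by have := Df (p, y + r *: v) v (yv r r01); rewrite /vderive tchart_center.
Qed.

(** The chart at u maps the fibres linearly, and segments to segments.  The radius e
    serves all points x of a neighbourhood, in order that the equality can be
    differentiated in x. *)
Lemma fibre_constant_chart (T : Type) (f : TM -> T) u : fibre_constant f ->
  slit u -> exists2 e : R, 0 < e & forall x y,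
    ball (chart c u.1 u.1) e x -> ball u.2 e y ->
    f (ichart tc u (x, y)) = f (ichart tc u (x, u.2)).
Proof.
move=> fc u0; have := near_slit hc u0; rewrite tchart_center //.
move=> /nbhs_ballP[e /= e0 H]; exists e => // x y xe ye.
have u2e : ball u.2 e u.2 by exact: ballxx.
set q := ichart c u.1 x.
pose A := 'd (chart c q \o ichart c u.1) x.
have key : forall r : R, 0 <= r <= 1 -> A u.2 + r *: (A y - A u.2) != 0.
  move=> r r01.
  have -> : A u.2 + r *: (A y - A u.2) = A (u.2 + r *: (y - u.2)).
    by rewrite -(raddfB A) -linearZ_LR -(raddfD A).
  by have := H (x, u.2 + r *: (y - u.2)) (conj xe (ball_segment u2e ye r01)).
by have := fc q (A u.2) (A y - A u.2) key; rewrite addrC subrK.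
Qed.

Lemma derive_base_near (T : normedModType R) (F : E * E -> T) x0 y0 (e : R) :
  0 < e -> (forall x y, ball x0 e x -> ball y0 e y -> F (x, y) = F (x, y0)) ->
  forall X y, ball y0 e y -> 'D_(X, 0) F (x0, y) = 'D_(X, 0) F (x0, y0).
Proof.
move=> e0 H X y ye.
apply: etrans (derive_fst _ _ _ _) _; apply: etrans _ (esym (derive_fst _ _ _ _)).
apply: near_eq_derive; apply: nearS (nbhsx_ballx x0 e e0) => x xe.
exact: H.
Qed.

End Fibres.

(** * Consequences of the existence of a concurrent field *)

Section Concurrent.
Context {R : realType} {n : nat} {M : Type} (c : charts M 'rV[R]_n).
Hypothesis hc : atlas c.
Local Notation E := 'rV[R]_n.
Local Notation tc := (tangent_charts c).
Local Notation TM := (M * 'rV[R]_n)%type.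
Let htc : atlas tc := tangent_atlas hc.
Variables (L : TM -> R) (hL : finsler c L).
Variables (D : connection_op) (hD : cartan_connection c L D).
Let lD := cartan_linear hD.
Let rD := cartan_regular hD.
Variables (zeta : TM -> E) (hz : concurrent c D zeta).
Implicit Types (u a : TM) (X Y Z : TM -> E) (v w y : E).
Local Notation g := (finsler_metric L).
Local Notation G := (christoffel c D).
Let sz u (u0 : slit u) : psection_smooth_at c zeta u := hz.1 u u0.

(** Every tangent vector is a horizontal lift plus a vertical one. *)
Lemma concurrent_conn u W : slit u -> D u W zeta = - W.1.
Proof.
move=> u0; have sf := smooth_frame hc u.
pose b := (W - hlift c D u W.1).2.
have eW : W = 1 *: hlift c D u W.1 + (0, b).
  have [_ h1] := hlift_spec hc rD W.1 u0.
  rewrite scale1r [LHS]surjective_pairing [hlift c D u _]surjective_pairing h1.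
  by congr pair; rewrite /= ?addr0 // addrC subrK.
rewrite [in LHS]eW (conn_linear lD u0 (sz u0)).
have [e1 _] := hz.2 u (frame c u W.1) u0 (sf W.1).
have [_ e2] := hz.2 u (frame c u b) u0 (sf b).
move: e1 e2; rewrite /cov /fhlift /fvlift vliftE //.
have -> := frame_center hc u W.1; have -> := frame_center hc u b.
by move=> -> ->; rewrite scale1r addr0.
Qed.

Let sqnorm a := g a (zeta a) (zeta a).

Let sqnorm_smooth u : slit u -> smooth_at tc sqnorm u.
Proof. by move=> u0; apply: smooth_metric => //; exact: sz. Qed.

Let sqnorm_derive u W : slit u -> vderive tc u W sqnorm = - (2 * g u W.1 (zeta u)).
Proof.
move=> u0; have := cartan_metrical hD u0 (sz u0) (sz u0) W.
have -> := concurrent_conn W u0; move=> e; apply: etrans e _.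
have a1 := metricNl hc hL u0 W.1 (zeta u).
have a2 := metricC hc hL u0 (zeta u) (- W.1).
apply: etrans (congr2 +%R a1 (etrans a2 a1)) _.
by rewrite mulr2n mulrDl mul1r opprD.
Qed.

(** By [sqnorm_derive] the vertical derivatives of sqnorm are zero. *)
Let sqnorm_fibre_constant : fibre_constant sqnorm.
Proof.
apply: (fibre_constantP hc) => u.
  by move=> u0; exact: smooth_near_diff (sqnorm_smooth u0).
move=> b u0; apply: etrans (sqnorm_derive (0, b) u0) _.
have e := metric0l hc hL u0 (zeta u).
by apply: etrans (congr1 (fun r => - (2 * r)) e) _; rewrite mulr0 oppr0.
Qed.

(** The covector - 2 g(zeta, -) is the differential of sqnorm, a function on the
    base. *)
Lemma pairing_locally_constant u v : slit u ->
  \forall y \near u.2, g (u.1, y) v (zeta (u.1, y)) = g u v (zeta u).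
Proof.
move=> u0; pose F := sqnorm \o ichart tc u.
have dF y : y != 0 ->
    'D_(v, 0) F (chart c u.1 u.1, y) = - (2 * g (u.1, y) v (zeta (u.1, y))).
  move=> y0; have uy0 : slit (u.1, y) by [].
  have d := smooth_near_diff (sqnorm_smooth uy0).
  have e := sqnorm_derive (v, 0) uy0; rewrite /vderive tchart_center // in e.
  rewrite tchart_center // in d.
  by apply: etrans (deriveE _ d) _; exact: e.
have [e e0 H] := fibre_constant_chart hc sqnorm_fibre_constant u0.
have N := @derive_base_near _ _ _ F _ _ e e0 H v.
apply: nearS2 (near_neq0 (u0 : u.2 != 0)) (nbhsx_ballx u.2 e e0) => y y0 /N N1.
have /oppr_inj e1 := etrans (esym (dF y y0)) (etrans N1 (dF u.2 u0)).
have t0 : (2 : R) != 0 by rewrite pnatr_eq0.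
by have := mulfI t0 e1; rewrite -surjective_pairing.
Qed.

(** The vertical derivative of g(v, zeta) for v constant, computed in two ways. *)
Let christoffel_pairing u x v : slit u -> g u (G u (0, x) v) (zeta u) = 0.
Proof.
move=> u0; have sf := smooth_frame hc u v.
have := cartan_metrical hD u0 sf (sz u0) (0, x).
have -> : D u (0, x) zeta = 0 by rewrite concurrent_conn // oppr0.
have -> := frame_center hc u v.
have e0 : g u v 0 = 0.
  exact: etrans (metricC hc hL u0 v 0) (metric0l hc hL u0 v).
move=> e; have {}e := etrans e (congr1 (fun r => _ + r) e0).
rewrite addr0 in e; apply: etrans (esym e) _.
pose F := (fun a => g a (frame c u v a) (zeta a)) \o ichart tc u.
have d : differentiable F (chart tc u u).
  exact: smooth_near_diff (smooth_metric hc hL u0 sf (sz u0)).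
apply: etrans (esym (deriveE (0, x) d)) _; rewrite tchart_center //.
apply: etrans (derive_snd F _ _ _) _.
apply: (@etrans _ _ ('D_x (cst (g u v (zeta u))) u.2)); last exact: derive_cst.
apply: near_eq_derive; apply: nearS (pairing_locally_constant v u0) => y ey.
have fe : frame c u v (u.1, y) = v by exact: (transd_id hc v (atlas_mem hc u.1)).
apply: (@etrans _ _ (g (u.1, y) (frame c u v (u.1, y)) (zeta (u.1, y)))).
  exact: (congr1 (fun a => g a (frame c u v a) (zeta a)) (ichart_fibre hc u y)).
by rewrite fe; exact: ey.
Qed.

(** By [christoffel_vert_sym] the argument zeta can be moved to the place of v in
    [christoffel_pairing]. *)
Lemma christoffel_concurrent u x : slit u -> G u (0, x) (zeta u) = 0.
Proof.
move=> u0; apply: (metric_nondegenerate hL u0) => v.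
exact: etrans (christoffel_vert_sym hc hD x _ _ u0) (christoffel_pairing x v u0).
Qed.

(** The vertical covariant derivative of zeta is zero and, zeta being in the kernel of
    the Cartan tensor, it is the derivative of zeta in a chart. *)
Lemma concurrent_fibre_constant : fibre_constant zeta.
Proof.
have dzeta u x : slit u ->
    'd (psection_rep c u zeta) (chart tc u u) (0, x) = 0.
  move=> u0; have := connE hc lD (0, x) u0 (sz u0).
  rewrite concurrent_conn // christoffel_concurrent // addr0 => <-.
  exact: oppr0.
move=> p y v yv; apply/rowP => i.
have zE y' : zeta (p, y') = psection_rep c (p, y) zeta (chart c p p, y').
  have := psection_rep_center hc (p, y') zeta.
  by rewrite tchart_center.
pose F := fun y' => row_coord i (zeta (p, y')).
have FE : F = fun y' =>
    row_coord i (psection_rep c (p, y) zeta (chart c p p, y')).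
  by apply/funext => y'; rewrite /F zE.
have d r : 0 <= r <= 1 -> differentiable
    (fun z => row_coord i (psection_rep c (p, y) zeta z)) (chart c p p, y + r *: v)
    /\ 'd (fun z => row_coord i (psection_rep c (p, y) zeta z))
      (chart c p p, y + r *: v) (0, v) = 0.
  move=> r01; have s : slit (p, y + r *: v) by exact: yv.
  have := dzeta (p, y + r *: v) v s; rewrite tchart_center // => e.
  have := sz s; rewrite /psection_smooth_at tchart_center // => S.
  have rc := @row_coord_continuous R n i.
  split; first exact: smooth_near_diff (smooth_near_linear rc S).
  apply: etrans (diff_linear_comp rc _ (smooth_near_diff S)) _.
  by apply: etrans (congr1 (row_coord i) e) _; exact: linear0.
apply: (@constant_line _ _ F) => r r01.
  rewrite FE; exact: (differentiable_fibre (d r r01).1).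
rewrite FE; apply: etrans (esym (derive_snd
  (fun z => row_coord i (psection_rep c (p, y) zeta z)) _ _ _)) _.
apply: etrans (deriveE (0, v) (d r r01).1) _.
exact: (d r r01).2.
Qed.

(** The Cartan tensor being totally symmetric, zeta can be moved from the direction of
    derivation to an argument of the metric. *)
Lemma diff_metric_concurrent u v w : slit u ->
  'd (local_metric c L u v w) (chart tc u u) (0, zeta u) = 0.
Proof.
move=> u0; apply: etrans (diff_metric_vert_sym hL (zeta u) v w u0) _.
apply: etrans (diff_metric_vert hc hL hD v (zeta u) w u0) _.
have e := congr1 (fun s => g u s w) (christoffel_concurrent v u0).
have e0 := etrans e (metric0l hc hL u0 w).
by apply: etrans (congr1 (fun r : R => 2 * r) e0) _; rewrite mulr0.
Qed.

End Concurrent.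

(** * Finsler manifolds with a concurrent field are Riemannian *)

Section Rigidity.
Context {R : realType} {n : nat} {M : Type} (c : charts M 'rV[R]_n).
Hypothesis hc : atlas c.
Local Notation E := 'rV[R]_n.
Local Notation tc := (tangent_charts c).
Local Notation TM := (M * 'rV[R]_n)%type.
Let htc : atlas tc := tangent_atlas hc.
Variables (L : TM -> R) (hL : finsler c L).
Variables (D : connection_op) (hD : cartan_connection c L D).
Let lD := cartan_linear hD.
Let rD := cartan_regular hD.
Variables (zeta : TM -> E) (hz : concurrent c D zeta).
Implicit Types (u a : TM) (X Y Z : TM -> E) (v w y d : E) (p : M).
Local Notation g := (finsler_metric L).

Lemma metric_fibreE p y v w :
  (fun y' => g (p, y') v w) =
  (fun y' => local_metric c L (p, y) v w (chart c p p, y')).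
Proof. by apply/funext => y'; rewrite -(local_metric_fibre hc L (p, y) y'). Qed.

Lemma metric_fibre_diff p y v w : y != 0 ->
  differentiable (fun y => g (p, y) v w) y.
Proof.
move=> y0; have := smooth_local_metric hL v w (y0 : slit (p, y)).
rewrite tchart_center // => /smooth_near_diff d.
by rewrite (metric_fibreE p y v w); exact: differentiable_fibre d.
Qed.

Lemma metric_fibre_derive p y v w x : y != 0 ->
  'D_x (fun y => g (p, y) v w) y =
  'd (local_metric c L (p, y) v w) (chart tc (p, y) (p, y)) (0, x).
Proof.
move=> y0; have := smooth_local_metric hL v w (y0 : slit (p, y)).
rewrite tchart_center // => /smooth_near_diff d.
rewrite (metric_fibreE p y v w); apply: etrans (esym (derive_snd _ _ _ _)) _.
exact: (deriveE (0, x) d).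
Qed.

(** Along the ray zeta keeps its value, so that [diff_metric_concurrent] applies at
    each of its points. *)
Lemma metric_ray p y v w (s t : R) : y != 0 -> 0 <= t ->
  (forall r : R, 0 <= r -> y + r *: (s *: zeta (p, y)) != 0) ->
  g (p, y + t *: (s *: zeta (p, y))) v w = g (p, y) v w.
Proof.
move=> y0 t0 ray; set d := t *: (s *: zeta (p, y)).
have nz r : 0 <= r -> y + r *: d != 0.
  move=> r0; have -> : r *: d = (r * t) *: (s *: zeta (p, y)) by rewrite -scalerA.
  exact: ray _ (mulr_ge0 r0 t0).
apply: (@constant_line _ _ (fun y => g (p, y) v w)) => r /andP[r0 r1].
  exact/metric_fibre_diff/nz.
apply: etrans (metric_fibre_derive p v w d (nz r r0)) _.
have zr : zeta (p, y + r *: d) = zeta (p, y).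
  apply: (concurrent_fibre_constant hc hL hD hz) => r' /andP[r'0 _].
  have -> : r' *: (r *: d) = (r' * r) *: d by rewrite scalerA.
  exact: nz _ (mulr_ge0 r'0 r0).
have e : (0, d) = (t * s) *: ((0, zeta (p, y + r *: d)) : E * E).
  by rewrite zr /d scalerA; congr pair; rewrite /= scaler0.
have e2 := diff_metric_concurrent hc hL hD hz v w (nz r r0 : slit (p, _)).
apply: etrans (congr1 _ e) _; apply: etrans (linearZ_LR _ _ _) _.
by apply: etrans (congr1 (fun q : R => t * s * q) e2) _; rewrite mulr0.
Qed.

(** With x the direction of the ray, g_(x + t y) = g_(y + x / t) = g_y for all
    positive t; then t tends to 0. *)
Lemma metric_ray_limit p y v w (s : R) : y != 0 -> s *: zeta (p, y) != 0 ->
  (forall r : R, 0 <= r -> y + r *: (s *: zeta (p, y)) != 0) ->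
  g (p, s *: zeta (p, y)) v w = g (p, y) v w.
Proof.
move=> y0; set x := s *: _ => x0 ray.
apply: (@half_line_limit _ _ (fun y => g (p, y) v w) x y).
  exact/differentiable_continuous/metric_fibre_diff.
move=> t t0; have tV : 0 <= t^-1 by rewrite invr_ge0 ltW.
have -> : x + t *: y = t *: (y + t^-1 *: x).
  by rewrite scalerDr scalerA mulfV ?lt0r_neq0// scale1r addrC.
apply: etrans (metric_homogeneous hc hL p v w (ray _ tV) t0) _.
exact: metric_ray.
Qed.

(** From each point of the segment at least one of the two rays in the directions
    zeta and - zeta avoids the origin, so the metric there is the metric at zeta or
    at - zeta. *)
Lemma metric_fibre_constant_nonzero p y d v w : zeta (p, y) != 0 ->
  (forall r : R, 0 <= r <= 1 -> y + r *: d != 0) ->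
  g (p, y + d) v w = g (p, y) v w.
Proof.
move=> z0 seg; set z := zeta (p, y) in z0 *.
pose phi (r : R) := g (p, y + r *: d) v w.
have cphi : {within `[0, 1], continuous phi}.
  apply: within_continuous_diff => r r01; apply/derivable1_diffP.
  have df := metric_fibre_diff p v w (seg r r01).
  by have [] := line_is_derive df.
have vals r : 0 <= r <= 1 ->
    phi r = g (p, 1 *: z) v w \/ phi r = g (p, -1 *: z) v w.
  move=> r01; have yr0 := seg r r01.
  have zr : zeta (p, y + r *: d) = z.
    apply: (concurrent_fibre_constant hc hL hD hz) => r' /andP[r'0 r'1].
    have -> : r' *: (r *: d) = (r' * r) *: d by rewrite scalerA.
    by apply: seg; case/andP: r01 => r0 r1; rewrite mulr_ge0 //= mulr_ile1.
  have lim (s : R) : s *: z != 0 -> (forall t : R, 0 <= t ->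
      y + r *: d + t *: (s *: z) != 0) -> phi r = g (p, s *: z) v w.
    rewrite -zr => sz0 ray; symmetry; exact: metric_ray_limit.
  have [ray|nray] := pselect (forall t : R, 0 <= t ->
      y + r *: d + t *: (1 *: z) != 0).
    by left; apply: lim => //; rewrite scale1r.
  right; apply: lim => [|t t0]; first by rewrite scaleN1r oppr_eq0.
  apply/eqP => e; apply: nray => t' t'0; apply/eqP => e'.
  (* otherwise z would vanish, or y would be the origin *)
  have : (t' + t) *: z = 0.
    have := congr2 (fun a b : E => a - b) e' e.
    rewrite subrr opprD addrACA subrr add0r.
    by rewrite scale1r scaleN1r scalerN opprK -scalerDl.
  move=> /eqP; rewrite scaler_eq0 (negPf z0) orbF paddr_eq0 // => /andP[_ /eqP t00].
  by move: e; rewrite t00 scale0r addr0; exact/eqP.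
have p0 : phi 0 = g (p, y) v w.
  by apply: (congr1 (fun y => g (p, y) v w)); rewrite scale0r addr0.
have p1 : phi 1 = g (p, y + d) v w.
  by apply: (congr1 (fun d => g (p, y + d) v w)); rewrite scale1r.
have := two_valued_constant cphi vals.
by clearbody phi; rewrite -p0 -p1 => ->.
Qed.

Let metric_derive_nonzero u (x : E) v w z :
  chart_dom tc u (ichart tc u z) -> chart tc u (ichart tc u z) = z ->
  slit (ichart tc u z) -> zeta (ichart tc u z) != 0 ->
  'D_(0, x) (local_metric c L u v w) z = 0.
Proof.
case: z => x1 y1 Dz ez qs zq.
apply: etrans (derive_snd _ _ _ _) _.
set q := ichart c u.1 x1; pose A := 'd (chart c q \o ichart c u.1) x1.
have AI y : A y = 0 -> y = 0.
  move=> Ay; have ex : chart c u.1 q = x1 by exact: (congr1 fst ez).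
  have := transdK hc y (Dz : chart_dom c u.1 q); rewrite ex.
  by move=> e; apply: etrans (esym e) _; apply: etrans (congr1 _ Ay) _; exact: linear0.
have y10 : y1 != 0.
  by apply/eqP => y10; move/eqP: qs; apply; rewrite /= y10; exact: linear0.
apply: (@etrans _ _ ('D_x (cst (local_metric c L u v w (x1, y1))) y1));
  last exact: derive_cst.
apply: near_eq_derive; apply: nearS (near_segment y10) => y yseg.
have seg r : 0 <= r <= 1 -> A y1 + r *: (A y - A y1) != 0.
  move=> r01; have -> : A y1 + r *: (A y - A y1) = A (y1 + r *: (y - y1)).
    by rewrite -(raddfB A) -linearZ_LR -(raddfD A).
  by apply/eqP => /AI; apply/eqP; exact: yseg.
have e := metric_fibre_constant_nonzero (A v) (A w) (zq : zeta (q, A y1) != 0) seg.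
rewrite addrC subrK in e.
have lmE y' : local_metric c L u v w (x1, y') = g (q, A y') (A v) (A w).
  exact: (local_metricE c L u v w (x1, y')).
have lmy := etrans (lmE y) (etrans e (esym (lmE y1))).
exact lmy.
Qed.

(** Where zeta vanishes its differential does not, so that u is a limit of points at
    which zeta is nonzero. *)
Lemma metric_derive_vert u (x : E) v w : slit u ->
  'D_(0, x) (local_metric c L u v w) (chart tc u u) = 0.
Proof.
move=> u0; apply/eqP/negPn/negP => ne.
have sP := smooth_near_derive (0, x) (smooth_local_metric hL v w u0).
have cP := differentiable_continuous (smooth_near_diff sP).
have NP : \forall z \near chart tc u u, 'D_(0, x) (local_metric c L u v w) z != 0.
  exact: (cP _ (near_neq0 ne)).
have Nz : \forall z \near chart tc u u, psection_rep c u zeta z = 0.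
  have N3 : \forall z \near chart tc u u, slit (ichart tc u z) /\
      'D_(0, x) (local_metric c L u v w) z != 0.
    by apply: nearS2 (near_slit hc u0) NP.
  apply: nearS2 (near_tangent hc u) N3.
  move=> z [Dz ez] [sz Pz]; have [e|nz] := eqVneq (zeta (ichart tc u z)) 0.
    apply: etrans (congr1 (pushvec c u.1 (ichart tc u z).1) e) _; exact: linear0.
  by move/eqP: Pz; have e := metric_derive_nonzero x v w Dz ez sz nz.
have zu : zeta u = 0.
  by rewrite -(psection_rep_center hc u zeta); exact: nbhs_singleton Nz.
have z0 : 'd (psection_rep c u zeta) (chart tc u u) (u.2, 0) = 0.
  have Nz' : \forall z \near chart tc u u,
      (cst 0 : E * E -> E) z = psection_rep c u zeta z.
    by apply: nearS Nz => z ->.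
  apply: etrans (diff_near (u.2, 0) Nz' (differentiable_cst _ _)) _.
  by rewrite diff_cst.
have := connE hc lD (u.2, 0) u0 (hz.1 u u0).
rewrite (concurrent_conn hc hD hz _ u0) z0 zu.
have -> : christoffel c D u (u.2, 0) 0 = 0.
  by have := christoffelZr hc lD (u.2, 0) 0 0 u0; rewrite !scale0r.
by rewrite addr0 => /eqP; rewrite oppr_eq0; exact/negP.
Qed.

Lemma metric_fibre_constant p y d v w :
  (forall r : R, 0 <= r <= 1 -> y + r *: d != 0) ->
  g (p, y + d) v w = g (p, y) v w.
Proof.
move=> seg; apply: (@constant_line _ _ (fun y => g (p, y) v w)) => r r01.
  exact/metric_fibre_diff/seg.
have s : slit (p, y + r *: d) := seg r r01.
apply: etrans (metric_fibre_derive p v w d s) _.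
apply: etrans (esym (deriveE (0, d) _)) (metric_derive_vert d v w s).
exact/smooth_near_diff/smooth_local_metric.
Qed.

Lemma concurrent_riemannian : riemannian L.
Proof.
move=> p y y' seg v w.
have yE (t : R) : (1 - t) *: y + t *: y' = y + t *: (y' - y).
  by rewrite scalerBl scale1r scalerBr -addrA [- _ + _]addrC.
have seg' (r : R) : 0 <= r <= 1 -> y + r *: (y' - y) != 0.
  by move=> r01; rewrite -yE; exact: seg.
have e : y + (y' - y) = y' by rewrite addrC subrK.
by have := metric_fibre_constant p v w seg'; rewrite e => ->.
Qed.

Lemma christoffel_vert0 u x v : slit u -> christoffel c D u (0, x) v = 0.
Proof.
move=> u0; apply: (metric_nondegenerate hL u0) => w.
have e := diff_metric_vert hc hL hD x v w u0.
have e2 := metric_derive_vert x v w u0.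
have d := smooth_near_diff (smooth_local_metric hL v w u0).
have e3 := etrans (esym e) (etrans (esym (deriveE (0, x) d)) e2).
by move/eqP: e3; rewrite mulf_eq0 pnatr_eq0 /= => /eqP.
Qed.

End Rigidity.

(** * Riemannian manifolds are Berwald and Landsberg *)

Section Bilinear.
Context {R : realType} {n : nat}.
Local Notation E := 'rV[R]_n.
Variables (B : E -> E -> E).
Hypotheses (BDl : forall x x' v, B (x + x') v = B x v + B x' v)
  (BZl : forall (t : R) x v, B (t *: x) v = t *: B x v)
  (BDr : forall x v v', B x (v + v') = B x v + B x v')
  (BZr : forall x (t : R) v, B x (t *: v) = t *: B x v).

Let B_continuous : continuous (fun p : E * E => B p.1 p.2).
Proof.
have Bsuml (I : Type) (r : seq I) (F : I -> E) v :
    B (\sum_(i <- r) F i) v = \sum_(i <- r) B (F i) v.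
  elim: r => [|i r IH]; last by rewrite !big_cons BDl IH.
  by rewrite !big_nil -[X in B X](scale0r 0) BZl scale0r.
have Bsumr (I : Type) (r : seq I) (F : I -> E) x :
    B x (\sum_(i <- r) F i) = \sum_(i <- r) B x (F i).
  elim: r => [|i r IH]; last by rewrite !big_cons BDr IH.
  by rewrite !big_nil -[X in B _ X](scale0r 0) BZr scale0r.
move=> p.
have S : smooth_near (fun p : E * E => \sum_i row_coord i p.1 *:
    \sum_j row_coord j p.2 *: B (delta_mx 0 i) (delta_mx 0 j)) p.
  apply: smooth_near_sum => i; apply: smooth_nearZ.
    apply: (smooth_near_linear (@row_coord_continuous R n i)).
    exact: (smooth_near_linear (@fst_continuous _ _ _) (smooth_near_id _)).
  apply: smooth_near_sum => j; apply: smooth_nearZ; last exact: smooth_near_cst.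
  apply: (smooth_near_linear (@row_coord_continuous R n j)).
  exact: (smooth_near_linear (@snd_continuous _ _ _) (smooth_near_id _)).
suff -> : (fun p : E * E => B p.1 p.2) = fun p : E * E => \sum_i row_coord i p.1 *:
    \sum_j row_coord j p.2 *: B (delta_mx 0 i) (delta_mx 0 j).
  exact: differentiable_continuous (smooth_near_diff S).
apply/funext => -[x v] /=; rewrite [in LHS](row_coordE x) Bsuml.
apply: eq_bigr => i _; rewrite BZl; congr (_ *: _).
by rewrite [in LHS](row_coordE v) Bsumr; apply: eq_bigr => j _; rewrite BZr.
Qed.

Lemma diff_bilinear (chi : E -> E) y : differentiable chi y ->
  differentiable (fun y => B (chi y) y) y /\
  forall d, 'd (fun y => B (chi y) y) y d = B ('d chi y d) y + B (chi y) d.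
Proof.
move=> dchi.
have bil : bilinear_for (GRing.Scale.Law.clone _ _ *:%R _)
    (GRing.Scale.Law.clone _ _ *:%R _) B.
  by split=> [v|x] t a b /=; rewrite ?BDl ?BDr ?BZl ?BZr.
pose bB := bilinear_isBilinear.Build R E E E _ _ _ bil.
pose b : {bilinear E -> E -> E} := HB.pack B bB.
have bc : continuous (fun p : E * E => b p.1 p.2) by exact: B_continuous.
have db := differentiable_bilin (chi y, y) bc.
have di : differentiable (id : E -> E) y by have [] := is_diff_id y.
have dp : differentiable (fun y => (chi y, id y)) y by exact: differentiable_pair.
have dc := @differentiable_comp _ _ _ _ (fun y => (chi y, y))
  (fun p : E * E => b p.1 p.2) y dp db.
split; first exact: dc.
move=> d.
have e := @diff_comp _ _ _ _ (fun y => (chi y, y)) (fun p : E * E => b p.1 p.2)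
  y dp db.
have [_ ei] := is_diff_id y.
have e2 : 'd (fun y => (chi y, y)) y d = ('d chi y d, d).
  apply: etrans (congr1 (fun l => l d) (diff_pair dchi di)) _.
  exact: (congr1 (fun l : E -> E => ('d chi y d, l d)) ei).
have e1 := congr1 (fun l => l d) e.
have e3 := congr1 (fun l => l ('d (fun y => (chi y, y)) y d))
  (diff_bilin (chi y, y) bc).
have e4 := congr1 (fun q : E * E => b (chi y) q.2 + b q.1 y) e2.
have e5 := etrans e1 (etrans e3 e4).
exact: etrans e5 (addrC _ _).
Qed.

End Bilinear.

Section RiemannianCase.
Context {R : realType} {n : nat} {M : Type} (c : charts M 'rV[R]_n).
Hypothesis hc : atlas c.
Local Notation E := 'rV[R]_n.
Local Notation tc := (tangent_charts c).
Local Notation TM := (M * 'rV[R]_n)%type.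
Let htc : atlas tc := tangent_atlas hc.
Variables (L : TM -> R) (hL : finsler c L).
Variables (D : connection_op) (hD : cartan_connection c L D).
Let lD := cartan_linear hD.
Let rD := cartan_regular hD.
Implicit Types (u a : TM) (X Y Z : TM -> E) (v w y d x : E) (p : M).
Local Notation g := (finsler_metric L).
Local Notation G := (christoffel c D).
Hypothesis vert0 : forall u x v, slit u -> G u (0, x) v = 0.

Lemma hvtorsion0 u X Y : slit u -> psection_smooth_at c X u ->
  psection_smooth_at c Y u -> hvtorsion c D X Y u = 0.
Proof.
move=> u0 sX sY; exact: etrans (hvtorsionE hc lD rD u0 sX sY) (vert0 _ _ u0).
Qed.

Lemma hvtorsion0_berwald : berwald c D.
Proof.
move=> u X Y Z u0 sX sY sZ; rewrite /hderive_hvtorsion.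
have sh := hlift_smooth hc lD rD u0 sX.
have e1 : cov D (fhlift c D X) (hvtorsion c D Y Z) u = 0.
  apply: (conn_near0 hc lD _ u0).
  have N := nearI (psection_smooth_near hc sY)
    (psection_smooth_near hc sZ).
  by apply: nearS2 (near_slit hc u0) N => z z0 [sYz sZz]; exact: hvtorsion0.
have e2 := hvtorsion0 u0 (conn_smooth lD u0 sh sY) sZ.
have e3 := hvtorsion0 u0 sY (conn_smooth lD u0 sh sZ).
by rewrite e1 e2 e3 !subr0.
Qed.

(** The direction (x, 0) is horizontal in the chart only; it may replace a horizontal
    lift because vertical Christoffel symbols vanish. *)
Definition hchristoffel u x v : E := G u (x, 0) v.
Local Notation H := hchristoffel.

Let GE u W v : slit u -> G u W v = H u W.1 v.
Proof.
move=> u0; have e : W = (W.1, 0) + (0, W.2).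
  by rewrite [LHS]surjective_pairing; congr pair; rewrite /= ?addr0 ?add0r.
rewrite [in LHS]e (christoffelDl hc lD _ _ _ u0) vert0 //.
exact: addr0.
Qed.

Let conn_mapE0 u W : slit u -> conn_map D u W = W.2 + H u W.1 u.2.
Proof. by move=> u0; rewrite (conn_mapE hc lD W u0) GE. Qed.

Let hliftE u x : slit u -> hlift c D u x = (x, - H u x u.2).
Proof.
move=> u0; symmetry; apply: (hlift_unique hc lD rD u0) => //.
by rewrite conn_mapE0 //= addNr.
Qed.

(** The h-torsion Q is zero. *)
Let HC u x v : slit u -> H u x v = H u v x.
Proof.
move=> u0; have sf := smooth_frame hc u.
have e1 := htorsionE hc lD rD u0 (sf x) (sf v).
have e2 := cartan_htorsion hD u0 (sf x) (sf v).
have := etrans (esym e1) e2.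
have -> := frame_center hc u x; have -> := frame_center hc u v.
by rewrite !GE // !hliftE //= => /eqP; rewrite subr_eq0 => /eqP.
Qed.

Lemma hchristoffelDl u x x' v : slit u -> H u (x + x') v = H u x v + H u x' v.
Proof. by move=> u0; rewrite -!(HC v) // /H christoffelDr. Qed.

Lemma hchristoffelZl u (t : R) x v : slit u -> H u (t *: x) v = t *: H u x v.
Proof. by move=> u0; rewrite -!(HC v) // /H christoffelZr. Qed.

Hypothesis gfc : forall p y d v w,
  (forall r : R, 0 <= r <= 1 -> y + r *: d != 0) ->
  g (p, y + d) v w = g (p, y) v w.

Let local_metric_near u : slit u -> exists2 e : R, 0 < e & forall v w x y,
  ball u.2 e y -> 'D_(x, 0) (local_metric c L u v w) (chart c u.1 u.1, y) =
  'D_(x, 0) (local_metric c L u v w) (chart c u.1 u.1, u.2).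
Proof.
move=> u0.
have gfc' : fibre_constant (fun a => (fun v w => g a v w) : E -> E -> R).
  by move=> p y d seg; apply/funext => v; apply/funext => w; exact: gfc.
have [e e0 He] := fibre_constant_chart hc gfc' u0.
exists e; first exact: e0.
move=> v w.
apply: (@derive_base_near _ _ _ (local_metric c L u v w) _ _ e e0) => x y xe ye.
pose A := transd c u.1 (ichart c u.1 x) x.
have lmE y' : local_metric c L u v w (x, y') = g (ichart tc u (x, y')) (A v) (A w).
  exact: (local_metricE c L u v w (x, y')).
have e1 : g (ichart tc u (x, y)) (A v) (A w) = g (ichart tc u (x, u.2)) (A v) (A w).
  exact: (congr1 (fun h : E -> E -> R => h (A v) (A w)) (He x y xe ye)).
have lmy := etrans (lmE y) (etrans e1 (esym (lmE u.2))).
exact lmy.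
Qed.

(** As for a Riemannian metric: g is parallel and the horizontal Christoffel symbols
    are symmetric. *)
Let koszul u x v w : slit u ->
  let dg x v w := 'D_(x, 0) (local_metric c L u v w) (chart c u.1 u.1, u.2) in
  2 * g u (H u x v) w = dg x v w + dg v x w - dg w x v.
Proof.
move=> u0 dg.
have dgE s t r : dg s t r = g u (H u s t) r + g u t (H u s r).
  rewrite -(christoffel_metric hc hL hD (s, 0) t r u0) tchart_center //.
  have := smooth_local_metric hL t r u0; rewrite tchart_center // => S.
  exact/deriveE/smooth_near_diff.
rewrite !dgE (HC v x u0) (HC w x u0) (HC w v u0).
have c1 := metricC hc hL u0 v (H u x w).
move: c1; move: (g u v (H u x w)) (g u (H u x w) v) => a b ->.
by move: (g u (H u x v) w) (g u x (H u v w)) => k l; ring.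
Qed.

(** By the Koszul formula, whose right-hand side depends on the base point only. *)
Let hchristoffel_near u : slit u -> \forall y \near u.2, slit (u.1, y) /\
  forall x v, H (u.1, y) x v = H u x v.
Proof.
move=> u0; have [e e0 He] := local_metric_near u0.
have N := nearI (near_neq0 (u0 : u.2 != 0)) (near_segment (u0 : u.2 != 0)).
apply: nearS2 (nbhsx_ballx u.2 e e0) N => y ye [y0 seg].
have gy v w : g (u.1, y) v w = g u v w.
  have := gfc u.1 v w seg.
  have -> : u.2 + (y - u.2) = y by rewrite addrC subrK.
  by rewrite -surjective_pairing.
have s : slit (u.1, y) := y0; split=> // x v.
apply/eqP; rewrite -subr_eq0; apply/eqP; apply: (metric_nondegenerate hL u0) => w.
have k1 := koszul x v w s; have k2 := koszul x v w u0.
have k : 2 * g (u.1, y) (H (u.1, y) x v) w = 2 * g u (H u x v) w.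
  have K := congr2 (fun a b : R => a - b)
    (congr2 +%R (He v w x y ye) (He x w v y ye)) (He x v w y ye).
  have K1 := etrans K (esym k2).
  exact (etrans k1 K1).
have t0 : (2 : R) != 0 by rewrite pnatr_eq0.
have k' := etrans (esym (gy _ _)) (mulfI t0 k).
apply: etrans (metricDl hc hL u0 _ _ w) _.
apply: etrans (congr2 +%R k' (metricNl hc hL u0 _ w)) _.
exact: subrr.
Qed.

(** In a chart the horizontal lift of X is (X, - H X y), where H does not depend on y.
    The covariant derivative of Y along this lift is equal to the value of the
    connection map on the bracket of this lift with the vertical lift of Y, and the
    middle term of the curvature is zero as the connection map vanishes on horizontal
    vectors. *)
Lemma riemannian_landsberg : landsberg c D.
Proof.
move=> u X Y u0 sX sY.
pose h := hlift c D u (X u).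
pose dY := 'd (psection_rep c u Y) (chart tc u u) h.
have t1 : cov D (fhlift c D X) (cov D (fvlift c Y) Defs.eta) u =
    dY + H u (X u) (Y u).
  have N : \forall z \near chart tc u u, Y (ichart tc u z) =
      cov D (fvlift c Y) Defs.eta (ichart tc u z).
    apply: nearS (near_slit hc u0) => z z0.
    have e := conn_mapE0 (vlift c (ichart tc u z) (Y (ichart tc u z))) z0.
    rewrite /cov /fvlift; apply: etrans (esym _) (esym e); rewrite vliftE //=.
    by rewrite /H vert0 // addr0.
  have e1 := conn_local lD u0 sY (psection_smooth_eq sY N) N h.
  apply: etrans (esym e1) _; apply: etrans (connE hc lD h u0 sY) _.
  by rewrite GE // /h (hlift_spec hc rD _ u0).2.
have t2 : cov D (fvlift c Y) (cov D (fhlift c D X) Defs.eta) u = 0.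
  apply: (conn_near0 hc lD _ u0); apply: nearS (near_slit hc u0) => z z0.
  exact: (hlift_spec hc rD _ z0).1.
pose chi y := X (u.1, y).
have psiE : \forall y \near u.2,
    (chi y, - H u (chi y) y) =
    vfield_rep tc u (fhlift c D X) (chart c u.1 u.1, y).
  apply: nearS (hchristoffel_near u0) => y [y0 Hy].
  have := vfield_rep_center hc (u.1, y) (fhlift c D X).
  rewrite tchart_center // => e; apply: etrans _ (esym e).
  by rewrite /fhlift hliftE // Hy.
have dchi : differentiable chi u.2.
  have S := sX; rewrite /psection_smooth_at tchart_center // in S.
  have E1 : chi = fun y => psection_rep c u X (chart c u.1 u.1, y).
    apply/funext => y; have := psection_rep_center hc (u.1, y) X.
    by rewrite tchart_center.
  by rewrite E1; exact: differentiable_fibre (smooth_near_diff S).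
pose delta := 'd chi (u.2) (Y u).
have t3 : bracket tc (fhlift c D X) (fvlift c Y) u =
    (0, dY) - (delta, - (H u delta u.2 + H u (X u) (Y u))).
  rewrite /bracket; congr (_ - _).
    have N := nearS (fun z => @esym _ _ _) (vfield_rep_fvlift hc u Y).
    have d0 : differentiable (cst 0 : E * E -> E) (chart tc u u).
      exact: differentiable_cst.
    have dYr := smooth_near_diff sY.
    apply: etrans (diff_near _ N (differentiable_pair d0 dYr)) _.
    apply: etrans (congr1 (fun l => l _) (diff_pair d0 dYr)) _.
    by congr pair; rewrite diff_cst.
  have sh := smooth_near_diff (hlift_smooth hc lD rD u0 sX).
  rewrite tchart_center // in sh *.
  rewrite {1}/fvlift vliftE // -deriveE //.
  apply: etrans (derive_snd _ _ _ _) _.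
  apply: etrans (esym (near_eq_derive _ psiE)) _.
  have [dB eB] := @diff_bilinear R n (H u)
    (fun x x' v => hchristoffelDl x x' v u0) (fun t x v => hchristoffelZl t x v u0)
    (fun x v v' => christoffelDr hc lD (x, 0) v v' u0)
    (fun x t v => christoffelZr hc lD (x, 0) t v u0) chi u.2 dchi.
  have dN := differentiableN dB.
  rewrite (deriveE _ (differentiable_pair dchi dN)) (diff_pair dchi dN).
  congr pair; rewrite (diffN dB); congr (- _); apply: etrans (eB (Y u)) _.
  by rewrite /chi -surjective_pairing.
have t4 : cov D (bracket tc (fhlift c D X) (fvlift c Y)) Defs.eta u =
    dY + H u (X u) (Y u).
  apply: etrans (conn_mapE0 _ u0) _; rewrite t3 /=.
  have -> : H u (0 - delta) u.2 = - H u delta u.2.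
    by rewrite add0r -scaleN1r hchristoffelZl // scaleN1r.
  have alg (k l m : E) : k + (l + m) - l = k + m by rewrite addrA addrAC addrK.
  by rewrite opprK; exact: alg.
have -> : hvcurvature_eta c D X Y u =
    - cov D (fhlift c D X) (cov D (fvlift c Y) Defs.eta) u +
    cov D (fvlift c Y) (cov D (fhlift c D X) Defs.eta) u +
    cov D (bracket tc (fhlift c D X) (fvlift c Y)) Defs.eta u by [].
by rewrite t1 t2 t4 addr0 addNr.
Qed.

End RiemannianCase.

Theorem theorem3p4 (R : realType) (n : nat) (M : topologicalType)
    (c : charts M 'rV[R]_n) (hM : smooth_manifold c)
    (L : M * 'rV[R]_n -> R) (hL : finsler c L)
    (nabla : connection_op) (hnabla : cartan_connection c L nabla)
    (hzeta : exists zeta : M * 'rV[R]_n -> 'rV[R]_n, concurrent c nabla zeta) :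
  (berwald c nabla <-> landsberg c nabla) /\
  (landsberg c nabla <-> riemannian L).
Proof.
have hc := manifold_atlas hM; have [zeta hz] := hzeta.
have T0 u x v := @christoffel_vert0 _ _ _ _ hc _ hL _ hnabla _ hz u x v.
have gfc p y d v w := @metric_fibre_constant _ _ _ _ hc _ hL _ hnabla _ hz p y d v w.
have B := hvtorsion0_berwald hc hnabla T0.
have K := riemannian_landsberg hc hL hnabla T0 gfc.
have G := concurrent_riemannian hc hL hnabla hz.
by split; split.
Qed.
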